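(* Let $k$ be a commutative ring, let $(\mathfrak{a},\mu)$ be a $cA_\infty$-category over $k$, let $\phi,\phi'\in\mathbf{C}^2(\mathfrak{a})$ be Hochschild cocycles and let $\eta\in\mathbf{C}^1(\mathfrak{a})$ satisfy $d_{Hoch}(\eta)=\phi'-\phi$. Write $\eta=\eta^0+\eta'$, where $\eta^0=(\eta^0_A)_A\in\prod_A\mathfrak{a}(A,A)^1$ is the projection of $\eta$ on the zero part. Let $f$ be the bijection $(A,\psi_A)\mapsto(A,\psi_A-\eta^0_A)$ on the objects of $\mathfrak{a}_\Psi$. Then $$1_f-\eta'_f\epsilon:\ \mathfrak{a}^{tot}_\phi[\epsilon]\longrightarrow\mathfrak{a}^{tot}_{\phi'}[\epsilon]$$ is an uncurved $cA_\infty$-isomorphism, which restricts to an $A_\infty$-isomorphism $$1_f-\eta'_f\epsilon:\ \mathfrak{a}^{cc}_\phi[\epsilon]\longrightarrow\mathfrak{a}^{cc}_{\phi'}[\epsilon].$$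
   Context: A $k$-quiver $\mathfrak{a}$ has a set of objects and $\mathbb{Z}$-graded $k$-modules $\mathfrak{a}(A,A')$; $(\Sigma V)^n=V^{n+1}$. For an object map $f:\mathrm{Ob}(\mathfrak{a})\to\mathrm{Ob}(\mathfrak{b})$, $\mathbf{C}(\mathfrak{a},\mathfrak{b})_f=\Sigma^{-1}\prod_{n\ge 0}\prod_{A_0,\dots,A_n}\mathrm{Hom}_k(\Sigma\mathfrak{a}(A_{n-1},A_n)\otimes\dots\otimes\Sigma\mathfrak{a}(A_0,A_1),\Sigma\mathfrak{b}(f(A_0),f(A_n)))$ and $\mathbf{C}(\mathfrak{a})=\mathbf{C}(\mathfrak{a},\mathfrak{a})_{1}$, $\mathbf{C}_{br}=\Sigma\mathbf{C}$. The factor $n=0$ is the zero part. Braces: $\phi\{\phi_1,\dots,\phi_m\}=\sum\phi(1\otimes\dots\otimes\phi_1\otimes1\dots\otimes\phi_m\otimes\dots\otimes1)$ (Koszul signs). A $cA_\infty$-structure is $\mu\in\mathbf{C}^2(\mathfrak{a})$ with $\mu\{\mu\}=0$; it is an $A_\infty$-structure if $\mu_0=0$. $d_{Hoch}=[\mu,-]$ with $[\phi,\psi]=\phi\{\psi\}-(-1)^{|\phi||\psi|}\psi\{\phi\}$ (degrees in $\mathbf{C}_{br}$). Morphisms: let $B\mathfrak{a}=\oplus_{n\ge0}(\Sigma\mathfrak{a})^{\otimes n}$ be the tensor cocategory (with $(\Sigma\mathfrak a)^{\otimes0}(A,A')$ equal to $k$ if $A=A'$ and $0$ otherwise, and deconcatenation),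 with codifferential the coderivation determined by $\mu$. A $cA_\infty$-morphism $(\mathfrak{a},\mu)\to(\mathfrak{b},\mu')$ with object map $f$ is $F\in\mathbf{C}^1(\mathfrak{a},\mathfrak{b})_f$ which extends to a (counital) cocategory morphism $B\mathfrak{a}\to B\mathfrak{b}$, with components $F^{\otimes n}\Delta^{(n-1)}$ (so for each argument only finitely many are nonzero), commuting with the codifferentials, and such that $\sum_m\mu'\{F_0^{\otimes m}\}$ converges. It is uncurved if $F_0=0$, and an isomorphism if it has an inverse $cA_\infty$-morphism for composition of cocategory morphisms. An $A_\infty$-isomorphism is such an isomorphism, with $F_0=0$, between $A_\infty$-categories. $k[\epsilon]$: dual numbers, $\epsilon^2=0$, $\epsilon$ of degree 0. For a 2-cocycle $\phi$, the linear deformation is $\mathfrak{a}_\phi[\epsilon]=(\mathfrak{a}\oplus\mathfrak{a}\epsilon,\mu+\phi\epsilon)$ over $k[\epsilon]$. The quiver $\mathfrak{a}_\Psi$ has objects $(A,\psi_A)$ with $A\in\mathfrak{a}$ and $\psi_A\in\mathfrak{a}(A,A)^1$ arbitrary, and $\mathfrak{a}_\Psi((A,\psi_A),(B,\psi_B))=\mathfrak{a}(A,B)$; Hochschild elements of $\mathfrak{a}$ extend trivially to $\mathfrak{a}_\Psi$; $\psi\in\mathbf{C}^1(\mathfrak{a}_\Psi)_0$ has component $\psi_A$ at $(A,\psi_A)$. The total deformation is $\mathfrak{a}^{tot}_\phi[\epsilon]=(\mathfrak{a}_\Psi)_{\phi+\mu\{\psi\}}[\epsilon]$, and the curvature compensating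 deformation $\mathfrak{a}^{cc}_\phi[\epsilon]$ is its full subcategory on the objects $(A,\psi_A)$ whose curvature $(\mu_0)_A+((\phi_0)_A+\mu_1(\psi_A))\epsilon$ vanishes. Since the Hom-modules of $\mathfrak{a}_\Psi$ do not depend on the chosen $\psi$'s, every $\kappa\in\mathbf{C}(\mathfrak{a}_\Psi)$ can be regarded as an element $\kappa_f\in\mathbf{C}(\mathfrak{a}_\Psi,\mathfrak{a}_\Psi)_f$ by composing with the identity maps $\mathfrak{a}_\Psi((A,\psi),(A',\psi'))=\mathfrak{a}(A,A')=\mathfrak{a}_\Psi(f(A,\psi),f(A',\psi'))$; $1_f$ is the element given by these identity maps. *)

(* Defs.v *)
From HB Require Import structures.
From mathcomp Require Import all_boot all_order all_algebra.
From mathcomp Require Import boolp classical_sets.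
Set Implicit Arguments.
Unset Strict Implicit.
Unset Printing Implicit Defensive.
Import GRing.Theory.
Local Open Scope ring_scope.
Local Open Scope quotient_scope.

(** * Modules presented by generators and relations *)

Section Presented.
Variables (R : comPzRingType) (T : Type).

Definition eval_fsum (M : lmodType R) (h : T -> M) (s : seq (R * T)) : M :=
  \sum_(p <- s) p.1 *: h p.2.

Variable rels : seq (R * T) -> Prop.

Definition respects (M : lmodType R) (h : T -> M) : Prop :=
  forall r, rels r -> eval_fsum h r = 0.

Definition pres_eq (s t : seq (R * {classic T})) : bool :=
  `[< forall (M : lmodType R) (h : T -> M),
      respects h -> eval_fsum h s = eval_fsum h t >].

Lemma pres_eq_refl : reflexive pres_eq.
Proof. by move=> s; apply/asboolP. Qed.

Lemma pres_eq_sym : symmetric pres_eq.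
Proof. by move=> s t; apply/asboolP/asboolP => h M g hg; rewrite h. Qed.

Lemma pres_eq_trans : transitive pres_eq.
Proof.
by move=> s r t /asboolP h /asboolP h'; apply/asboolP => M g hg; rewrite h ?h'.
Qed.

Canonical pres_equiv := EquivRel pres_eq pres_eq_refl pres_eq_sym pres_eq_trans.

(* The R-module with generators T and relations "r = 0" for r in rels: formal
   sums modulo the equalities that hold in every R-module in which the
   relations hold. *)
Definition pres := {eq_quot pres_equiv}.
HB.instance Definition _ := Choice.on pres.

Definition fclass (s : seq (R * T)) : pres := \pi_pres s.
Definition pres_gen (x : T) : pres := fclass [:: (1, x)].

(* The map pres -> M induced by h; meaningful when h respects the relations
   (see pres_lift_class and pres_lift_linear). *)
Definition pres_lift (M : lmodType R) (h : T -> M) (z : pres) : M :=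
  eval_fsum h (repr z).

Lemma pres_lift_class (M : lmodType R) (h : T -> M) s :
  respects h -> pres_lift h (fclass s) = eval_fsum h s.
Proof.
move=> hh; rewrite /pres_lift /fclass; case: piP => t /eqmodP /asboolP e.
by rewrite (e M h hh).
Qed.

Lemma fclass_eq s t :
  (forall (M : lmodType R) (h : T -> M),
     respects h -> eval_fsum h s = eval_fsum h t) -> fclass s = fclass t.
Proof. by move=> h; apply/eqmodP/asboolP. Qed.

Lemma pres_ind_class (P : pres -> Prop) : (forall s, P (fclass s)) -> forall z, P z.
Proof. by move=> h z; rewrite -[z]reprK; apply: h. Qed.

Lemma eval_cat (M : lmodType R) (h : T -> M) s t :
  eval_fsum h (s ++ t) = eval_fsum h s + eval_fsum h t.
Proof. by rewrite /eval_fsum big_cat. Qed.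

Definition fscale (c : R) (s : seq (R * T)) := [seq (c * p.1, p.2) | p <- s].

Lemma eval_fscale (M : lmodType R) (h : T -> M) c s :
  eval_fsum h (fscale c s) = c *: eval_fsum h s.
Proof.
by rewrite /eval_fsum big_map scaler_sumr; apply: eq_bigr => p _; rewrite scalerA.
Qed.

Lemma eval_nil (M : lmodType R) (h : T -> M) : eval_fsum h [::] = 0.
Proof. by rewrite /eval_fsum big_nil. Qed.

Definition pres_zero : pres := fclass [::].
Definition pres_add (x y : pres) : pres := fclass (repr x ++ repr y).
Definition pres_scale (c : R) (x : pres) : pres := fclass (fscale c (repr x)).
Definition pres_opp (x : pres) : pres := pres_scale (-1) x.

Lemma pres_ext (x y : pres) :
  (forall (M : lmodType R) (h : T -> M),
     respects h -> pres_lift h x = pres_lift h y) -> x = y.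
Proof.
elim/pres_ind_class: x => s; elim/pres_ind_class: y => t e.
by apply: fclass_eq => M h hh; rewrite -!pres_lift_class ?e.
Qed.

Section Lift.
Variables (M : lmodType R) (h : T -> M).
Hypothesis hh : respects h.

Lemma pres_lift_zero : pres_lift h pres_zero = 0.
Proof. by rewrite pres_lift_class ?eval_nil. Qed.

Lemma pres_lift_add x y : pres_lift h (pres_add x y) = pres_lift h x + pres_lift h y.
Proof. by rewrite pres_lift_class ?eval_cat. Qed.

Lemma pres_lift_scale c x : pres_lift h (pres_scale c x) = c *: pres_lift h x.
Proof. by rewrite pres_lift_class ?eval_fscale. Qed.
End Lift.

Fact pres_addA : associative pres_add.
Proof. by move=> x y z; apply: pres_ext => M h hh; rewrite !pres_lift_add ?addrA. Qed.
Fact pres_addC : commutative pres_add.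
Proof. by move=> x y; apply: pres_ext => M h hh; rewrite !pres_lift_add 1?addrC. Qed.
Fact pres_add0 : left_id pres_zero pres_add.
Proof. by move=> x; apply: pres_ext => M h hh; rewrite pres_lift_add ?pres_lift_zero ?add0r. Qed.
Fact pres_addN : left_inverse pres_zero pres_opp pres_add.
Proof.
move=> x; apply: pres_ext => M h hh.
by rewrite pres_lift_add ?pres_lift_scale ?pres_lift_zero ?scaleN1r ?addNr.
Qed.
HB.instance Definition _ :=
  GRing.isZmodule.Build pres pres_addA pres_addC pres_add0 pres_addN.

Fact pres_scaleA a b x : pres_scale a (pres_scale b x) = pres_scale (a * b) x.
Proof. by apply: pres_ext => M h hh; rewrite !pres_lift_scale ?scalerA. Qed.
Fact pres_scale1 : left_id 1 pres_scale.
Proof. by move=> x; apply: pres_ext => M h hh; rewrite pres_lift_scale ?scale1r. Qed.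
Fact pres_scaleDr : right_distributive pres_scale +%R.
Proof.
move=> c x y; apply: pres_ext => M h hh.
by rewrite pres_lift_scale ?[x + y]/(pres_add x y) ?[RHS]pres_lift_add ?pres_lift_add
  ?pres_lift_scale ?scalerDr.
Qed.
Fact pres_scaleDl x : {morph pres_scale^~ x : a b / a + b}.
Proof.
move=> a b; apply: pres_ext => M h hh.
by rewrite pres_lift_scale ?[RHS]pres_lift_add ?pres_lift_scale ?scalerDl.
Qed.
HB.instance Definition _ := GRing.Zmodule_isLmodule.Build R pres
  pres_scaleA pres_scale1 pres_scaleDr pres_scaleDl.

Lemma pres_lift_linear (M : lmodType R) (h : T -> M) : respects h -> linear (pres_lift h).
Proof.
by move=> hh c x y; rewrite [LHS](pres_lift_add hh) (pres_lift_scale hh).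
Qed.

Lemma pres_lift_gen (M : lmodType R) (h : T -> M) x : respects h -> pres_lift h (pres_gen x) = h x.
Proof. by move=> hh; rewrite pres_lift_class // /eval_fsum big_seq1 scale1r. Qed.

Lemma fclassE s : fclass s = \sum_(p <- s) p.1 *: pres_gen p.2.
Proof.
apply: pres_ext => M h hh; pose L := GRing.isLinear.Build _ _ _ _ _ (pres_lift_linear hh).
pose l : {linear pres -> M} := HB.pack (pres_lift h) L.
rewrite -[pres_lift h (\sum_(p <- s) _)]/(l _) linear_sum pres_lift_class //.
by apply: eq_bigr => p _; rewrite linearZ /= pres_lift_gen.
Qed.

Lemma pres_gen_respects : respects pres_gen.
Proof.
move=> r hr; rewrite -[eval_fsum _ _]/(\sum_(p <- r) p.1 *: pres_gen p.2) -fclassE.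
by apply: pres_ext => M h hh; rewrite pres_lift_class // hh // pres_lift_zero.
Qed.

End Presented.

(** * Graded modules *)

(* A Z-graded module is its total module with the projections on the
   homogeneous components. *)
Record grmod (R : comPzRingType) := GrMod {
  gsort :> lmodType R;
  gpr : int -> {linear gsort -> gsort};
  gprK : forall m n x, gpr m (gpr n x) = if m == n then gpr n x else 0;
  gdec : forall x, exists s : seq int, uniq s && (x == \sum_(n <- s) gpr n x)
}.

Definition homog (R : comPzRingType) (V : grmod R) (d : int) (x : V) : Prop :=
  gpr V d x = x.

(* x |-> (-1)^|x| x *)
Definition gsign (R : comPzRingType) (V : grmod R) (x : V) : V :=
  \sum_(n <- xchoose (gdec x)) (-1) ^+ `|n|%N *: gpr V n x.

Section GradedTheory.
Variables (R : comPzRingType) (V : grmod R).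

Lemma gpr_out (x : V) s n : x = \sum_(m <- s) gpr V m x -> n \notin s -> gpr V n x = 0.
Proof.
move=> -> hn; rewrite linear_sum big1_seq // => m /= hm.
by rewrite gprK; case: eqP hn => // ->; rewrite hm.
Qed.

Lemma gpr_sum_support (x : V) s t (c : int -> R) :
  uniq s -> uniq t -> x = \sum_(m <- s) gpr V m x -> {subset s <= t} ->
  \sum_(m <- t) c m *: gpr V m x = \sum_(m <- s) c m *: gpr V m x.
Proof.
move=> us ut ex st; rewrite (bigID (mem s)) /= [X in _ + X]big1 ?addr0; last first.
  by move=> i hi; rewrite (gpr_out ex hi) scaler0.
rewrite -big_filter; apply: perm_big; apply: uniq_perm => // [|i].
  exact: filter_uniq.
by rewrite mem_filter; apply/andP/idP => [[]//|hi]; rewrite hi st.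
Qed.

Lemma gsignE (x : V) s : uniq s -> x = \sum_(m <- s) gpr V m x ->
  gsign x = \sum_(m <- s) (-1) ^+ `|m|%N *: gpr V m x.
Proof.
move=> us es; rewrite /gsign; have /andP[ut /eqP et] := xchooseP (gdec x).
pose w := undup (s ++ xchoose (gdec x)).
transitivity (\sum_(m <- w) (-1) ^+ `|m|%N *: gpr V m x).
  rewrite (gpr_sum_support _ ut (undup_uniq _) et) // => m hm.
  by rewrite mem_undup mem_cat hm orbT.
rewrite (gpr_sum_support _ us (undup_uniq _) es) // => m hm.
by rewrite mem_undup mem_cat hm.
Qed.

Lemma gsign_linear : linear (@gsign R V).
Proof.
move=> c x y; have /andP[ux /eqP ex] := xchooseP (gdec x).
have /andP[uy /eqP ey] := xchooseP (gdec y).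
set s := xchoose (gdec x) in ux ex; set t := xchoose (gdec y) in uy ey.
pose w := undup (s ++ t); have uw : uniq w by apply: undup_uniq.
have hs : {subset s <= w} by move=> m hm; rewrite mem_undup mem_cat hm.
have ht : {subset t <= w} by move=> m hm; rewrite mem_undup mem_cat hm orbT.
have wx : x = \sum_(m <- w) gpr V m x.
  rewrite {1}ex; have := gpr_sum_support (fun=> 1) ux uw ex hs.
  by under eq_bigr do rewrite scale1r; under [RHS]eq_bigr do rewrite scale1r.
have wy : y = \sum_(m <- w) gpr V m y.
  rewrite {1}ey; have := gpr_sum_support (fun=> 1) uy uw ey ht.
  by under eq_bigr do rewrite scale1r; under [RHS]eq_bigr do rewrite scale1r.
rewrite (gsignE uw wx) (gsignE uw wy) (gsignE (s := w) uw); last first.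
  rewrite {1}wx {1}wy scaler_sumr -big_split; apply: eq_bigr => m _ /=.
  by rewrite linearP.
rewrite scaler_sumr -big_split; apply: eq_bigr => m _ /=.
by rewrite linearP scalerDr !scalerA mulrC.
Qed.

Lemma gsign_homog d (x : V) : homog d x -> gsign x = (-1) ^+ `|d|%N *: x.
Proof.
move=> hx; rewrite (gsignE (s := [:: d])) ?big_seq1 // hx //.
Qed.

End GradedTheory.

Fact gshift_gprK (R : comPzRingType) (V : grmod R) (m n : int) (x : V) :
  gpr V (m + 1) (gpr V (n + 1) x) = if m == n then gpr V (n + 1) x else 0.
Proof. by rewrite gprK (inj_eq (addIr 1)). Qed.

Fact gshift_gdec (R : comPzRingType) (V : grmod R) (x : V) :
  exists s : seq int, uniq s && (x == \sum_(n <- s) gpr V (n + 1) x).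
Proof.
have /andP[us /eqP es] := xchooseP (gdec x).
exists [seq n - 1 | n <- xchoose (gdec x)]; apply/andP; split.
  by rewrite map_inj_uniq //; apply: addIr.
rewrite big_map {1}es; apply/eqP/eq_bigr => n _.
by rewrite subrK.
Qed.

(* (Sigma V)^n = V^(n+1) *)
Definition gshift (R : comPzRingType) (V : grmod R) : grmod R :=
  @GrMod R V (fun n => gpr V (n + 1)) (@gshift_gprK R V) (@gshift_gdec R V).

(** * Quivers and words *)

Record quiver (R : comPzRingType) := Quiver {
  Ob :> Type;
  qhom : Ob -> Ob -> grmod R
}.
Arguments qhom {R} q A B.

Definition qshift (R : comPzRingType) (a : quiver R) : quiver R :=
  @Quiver R a (fun A B => gshift (qhom a A B)).

(* The quiver f^* a *)
Definition qpull (R : comPzRingType) (a : quiver R) (X : Type) (f : X -> Ob a) :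
  quiver R := @Quiver R X (fun x y => qhom a (f x) (f y)).
Arguments qpull {R} a {X} f.

(* Composable words from A to C.  The leftmost letter is the last arrow of the
   path, as in V(A_(n-1),A_n) (x) ... (x) V(A_0,A_1). *)
Inductive word (R : comPzRingType) (V : quiver R) : Ob V -> Ob V -> Type :=
| wnil A : word A A
| wcons A B C (x : qhom V B C) (w : word A B) : word A C.
Arguments word {R} V A C.
Arguments wnil {R V} A.
Arguments wcons {R V A B C} x w.

Section Words.
Variables (R : comPzRingType) (V : quiver R).

Fixpoint wcat A B C (u : word V B C) : word V A B -> word V A C :=
  match u in word _ B C return word V A B -> word V A C with
  | wnil _ => fun v => v
  | wcons _ _ _ x u' => fun v => wcons x (wcat u' v)
  end.

(* All factorizations w = u v *)
Fixpoint splits A C (w : word V A C) : seq {B : Ob V & word V B C * word V A B}%type :=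
  match w in word _ A C return seq {B : Ob V & word V B C * word V A B}%type with
  | wnil A => [:: existT _ A (wnil A, wnil A)]
  | wcons A B C x w' =>
      existT _ C (wnil C, wcons x w') ::
      [seq existT (fun D => word V D C * word V A D)%type (tag p)
             (wcons x (tagged p).1, (tagged p).2) | p <- splits w']
  end.

(* The word with the sign operator to the power p applied to every letter *)
Fixpoint wsign (p : int) A C (w : word V A C) : word V A C :=
  match w in word _ A C return word V A C with
  | wnil A => wnil A
  | wcons _ _ _ x w' => wcons (iter `|p|%N (@gsign _ _) x) (wsign p w')
  end.

(* All letters are homogeneous, of total degree d *)
Fixpoint whomog A C (w : word V A C) (d : int) : Prop :=
  match w with
  | wnil _ => d = 0
  | wcons _ _ _ x w' => exists e, homog e x /\ whomog w' (d - e)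
  end.

Lemma splits_cat A B D C (u : word V D C) (x : qhom V B D) (v : word V A B) :
  splits (wcat u (wcons x v)) =
  [seq existT (fun E => word V E C * word V A E)%type (tag p)
         ((tagged p).1, wcat (tagged p).2 (wcons x v)) | p <- splits u] ++
  [seq existT (fun E => word V E C * word V A E)%type (tag p)
         (wcat u (wcons x (tagged p).1), (tagged p).2) | p <- splits v].
Proof.
elim: u x v => [E|E F G y u IH] x v //=.
by rewrite IH map_cat -!map_comp /=.
Qed.

Lemma wcatA A B C D (u : word V C D) (v : word V B C) (w : word V A B) :
  wcat (wcat u v) w = wcat u (wcat v w).
Proof. by elim: u v => //= E F G x u IH v; rewrite IH. Qed.

Lemma wsign_cat p A B C (u : word V B C) (v : word V A B) :
  wsign p (wcat u v) = wcat (wsign p u) (wsign p v).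
Proof. by elim: u v => //= E F G x u IH v; rewrite IH. Qed.

Lemma wsign0 A C (w : word V A C) : wsign 0 w = w.
Proof. by elim: w => //= E F G x u ->. Qed.

End Words.

Fixpoint wpull (R : comPzRingType) (V : quiver R) (X : Type) (f : X -> Ob V)
    (x y : X) (w : word (qpull V f) x y) : word V (f x) (f y) :=
  match w in word _ x y return word V (f x) (f y) with
  | wnil x => wnil (f x)
  | wcons _ _ _ l w' => @wcons R V _ _ _ l (wpull w')
  end.

(** * Cochains *)

(* A word carries n and A_0, ..., A_n, so this is a family of maps with n
   arguments indexed by n and A_0, ..., A_n. *)
Definition cochain (R : comPzRingType) (V W : quiver R) (f : Ob V -> Ob W) :=
  forall A C : V, word V A C -> qhom W (f A) (f C).

Definition multilinear (R : comPzRingType) (V : quiver R) (A C : V)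
    (M : lmodType R) (h : word V A C -> M) : Prop :=
  forall (B D : V) (u : word V D C) (v : word V A B) (c : R) (x y : qhom V B D),
    h (wcat u (wcons (c *: x + y) v))
    = c *: h (wcat u (wcons x v)) + h (wcat u (wcons y v)).

Arguments cochain {R} V W f.
Notation Endo V := (cochain V V idfun).

(* phi is an element of degree p of
   prod_n prod_(A_0..A_n) Hom_k(V(A_(n-1),A_n) (x) .. (x) V(A_0,A_1),
                                W(f A_0, f A_n)) *)
Definition of_degree (R : comPzRingType) (V W : quiver R) (f : Ob V -> Ob W)
    (p : int) (phi : cochain V W f) : Prop :=
  forall A C : V, multilinear (phi A C)
    /\ forall w d, whomog w d -> homog (d + p) (phi A C w).

Notation Cochain a b f := (cochain (qshift a) (qshift b) f).
Notation "'CC' a" := (Cochain a a idfun) (at level 9, a at level 8).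

(* phi \in C^n(a,b)_f, that is, of degree n - 1 in C_br = Sigma C *)
Definition hochschild (R : comPzRingType) (a b : quiver R) (f : Ob a -> Ob b)
    (n : int) (phi : Cochain a b f) : Prop := of_degree (n - 1) phi.

Definition cpull (R : comPzRingType) (V : quiver R) (X : Type) (f : X -> Ob V)
    (phi : Endo V) : Endo (qpull V f) :=
  fun x y w => phi (f x) (f y) (wpull w).
Arguments cpull {R} V {X} f phi A C w.

(* The cochain concentrated in the zero part with components c_A *)
Definition zcochain (R : comPzRingType) (V : quiver R) (c : forall A : V, qhom V A A) :
    Endo V :=
  fun A C w =>
    match w in word _ A C return qhom V A C with
    | wnil A => c A
    | wcons _ _ _ _ _ => 0
    end.

(* The cochain of identity maps, concentrated in arity one *)
Definition idcochain (R : comPzRingType) (V : quiver R) : Endo V :=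
  fun A C w =>
    match w in word _ A C return qhom V A C with
    | wnil A => 0
    | wcons A B C x w' =>
        match w' in word _ A B return qhom V B C -> qhom V A C with
        | wnil _ => fun x => x
        | wcons _ _ _ _ _ => fun _ => 0
        end x
    end.

Section Braces.
Variables (R : comPzRingType) (V : quiver R).

(* The terms of (1 (x) .. (x) phi_1 (x) 1 (x) .. (x) phi_m (x) .. (x) 1)(w),
   where l lists the phi_i with their degrees.  The Koszul rule is
   (f (x) g)(x (x) y) = (-1)^(|g||x|) f x (x) g y: each phi_i acquires the
   sign of all the letters of w on its left, including those that are
   arguments of some phi_j with j < i. *)
Fixpoint insertions (l : seq (int * Endo V)) A C (w : word V A C) :
    seq (word V A C) :=
  match l with
  | [::] => [:: w]
  | p :: l' =>
      let q := \sum_(r <- l') r.1 in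
      flatten [seq
        let: existT B (u, s) := z in
        flatten [seq
          let: existT D (v, t) := z' in
          [seq wcat (wsign (p.1 + q) u) (wcons (p.2 D B (wsign q v)) t')
          | t' <- insertions l' t]
        | z' <- splits s]
      | z <- splits w]
  end.

(* phi{phi_1, ..., phi_m} *)
Definition brace (phi : Endo V) (l : seq (int * Endo V)) : Endo V :=
  fun A C w => \sum_(v <- insertions l w) phi A C v.

(* [phi, psi] for phi, psi of degrees p, q *)
Definition gbracket (p q : int) (phi psi : Endo V) : Endo V :=
  fun A C w => brace phi [:: (q, psi)] w
               - (-1) ^+ `|(p * q)%R|%N *: brace psi [:: (p, phi)] w.

Lemma insertions1 (M : lmodType R) A C (h : word V A C -> M) p phi (w : word V A C) :
  \sum_(v <- insertions [:: (p, phi)] w) h v =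
  \sum_(z <- splits w) \sum_(y <- splits (tagged z).2)
     h (wcat (wsign p (tagged z).1) (wcons (phi _ _ (tagged y).1) (tagged y).2)).
Proof.
rewrite /= big_nil addr0 big_flatten big_map; apply: eq_bigr => -[B [u s]] _ /=.
rewrite big_flatten big_map; apply: eq_bigr => -[D [v t]] _ /=.
by rewrite big_seq1 wsign0.
Qed.

Lemma insertions1_mlin (M : lmodType R) A C (h : word V A C -> M) p (phi : Endo V) :
  multilinear h -> (forall B D, multilinear (phi B D)) ->
  multilinear (fun w => \sum_(v <- insertions [:: (p, phi)] w) h v).
Proof.
move=> hh hphi B D u v c x y.
have gl E F : linear (iter `|p|%N (@gsign R (qhom V E F))).
  by elim: `|p|%N => // n IH a b b'; rewrite !iterS IH gsign_linear.
rewrite !insertions1 !splits_cat !big_cat /= !big_map /=.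
rewrite scalerDr addrACA !scaler_sumr -!big_split /=.
congr (_ + _); apply: eq_bigr => -[E [u1 u2]] _ /=.
  rewrite !splits_cat !big_cat /= !big_map /= scalerDr addrACA !scaler_sumr.
  rewrite -!big_split /=; congr (_ + _); apply: eq_bigr => -[F [w1 w2]] _ /=.
    have e t : wcat (wsign p u1) (wcons (phi _ _ w1) (wcat w2 (wcons t v))) =
        wcat (wcat (wsign p u1) (wcons (phi _ _ w1) w2)) (wcons t v).
      by rewrite wcatA.
    by rewrite !e hh.
  by rewrite hphi hh.
rewrite scaler_sumr -big_split /=; apply: eq_bigr => -[F [w1 w2]] _ /=.
by rewrite !wsign_cat /= gl !wcatA /= hh.
Qed.

End Braces.

Section HochschildStructures.
Variables (R : comPzRingType) (a : quiver R).

Definition cAinf_structure (mu : CC a) : Prop :=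
  hochschild 2 mu /\ forall A C w, brace mu [:: (1, mu)] (A := A) (C := C) w = 0.

Definition curvature (mu : CC a) (A : a) : qhom a A A :=
  mu A A (wnil (V := qshift a) A).

Definition Ainf_structure (mu : CC a) : Prop :=
  cAinf_structure mu /\ forall A, curvature mu A = 0.

(* d_Hoch on C^n(a) *)
Definition dHoch (mu : CC a) (n : int) (phi : CC a) : CC a :=
  gbracket 1 (n - 1) mu phi.

Definition hcocycle (mu : CC a) (n : int) (phi : CC a) : Prop :=
  hochschild n phi /\ forall A C w, dHoch mu n phi (A := A) (C := C) w = 0.

End HochschildStructures.

(** * The tensor cocategory *)

Section TensorCocategory.
Variables (R : comPzRingType) (V : quiver R).

Definition mlin_rels (A C : V) (r : seq (R * word V A C)) : Prop :=
  exists B D (u : word V D C) (v : word V A B) (c : R) (x y : qhom V B D),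
    r = [:: (1, wcat u (wcons (c *: x + y) v));
            (- c, wcat u (wcons x v)); (- 1, wcat u (wcons y v))].

(* (+)_n (+)_(A = A_0, .., A_n = C) V(A_(n-1),A_n) (x) .. (x) V(A_0,A_1) *)
Definition tcoc (A C : V) : lmodType R := pres (@mlin_rels A C).

Definition tword A C (w : word V A C) : tcoc A C := pres_gen (@mlin_rels A C) w.

Lemma mlin_respects A C (M : lmodType R) (h : word V A C -> M) :
  multilinear h <-> respects (@mlin_rels A C) h.
Proof.
split=> [hh r [B [D [u [v [c [x [y ->]]]]]]]|hh B D u v c x y].
  by rewrite /eval_fsum !big_cons big_nil /= hh !scale1r scaleN1r scaleNr addr0 
    addrACA !subrr addr0.
have := hh _ (ex_intro _ B (ex_intro _ D (ex_intro _ u (ex_intro _ v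
  (ex_intro _ c (ex_intro _ x (ex_intro _ y erefl))))))).
rewrite /eval_fsum !big_cons big_nil /= scale1r scaleN1r scaleNr addr0 -opprD.
by move/eqP; rewrite subr_eq0 => /eqP.
Qed.

Lemma tword_mlin A C : multilinear (@tword A C).
Proof. exact/mlin_respects/pres_gen_respects. Qed.

End TensorCocategory.
Arguments tcoc {R} V A C.

(* The tensor product of two k-linear quivers on the same objects:
   (P (x) Q)(A, C) = (+)_B P(B, C) (x) Q(A, B). *)
Section TensorSquare.
Variables (R : comPzRingType) (O : Type) (P : O -> O -> lmodType R).

Definition bilin_rels (A C : O) (r : seq (R * {B : O & P B C * P A B}%type)) : Prop :=
  exists B, (exists (c : R) (x y : P B C) (z : P A B),
      r = [:: (1, existT _ B (c *: x + y, z));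
              (- c, existT _ B (x, z)); (- 1, existT _ B (y, z))])
    \/ (exists (c : R) (x : P B C) (y z : P A B),
      r = [:: (1, existT _ B (x, c *: y + z));
              (- c, existT _ B (x, y)); (- 1, existT _ B (x, z))]).

Definition tsquare (A C : O) : lmodType R := pres (@bilin_rels A C).

Definition tpair A B C (x : P B C) (y : P A B) : tsquare A C :=
  pres_gen (@bilin_rels A C)
    (existT (fun B => P B C * P A B)%type B (x, y)).

Lemma tpair_linearl A B C c (x x' : P B C) (y : P A B) :
  tpair (c *: x + x') y = c *: tpair x y + tpair x' y.
Proof.
have := @pres_gen_respects _ _ (@bilin_rels A C) _
  (ex_intro _ B (or_introl (ex_intro _ c (ex_intro _ x
    (ex_intro _ x' (ex_intro _ y erefl)))))).
rewrite /eval_fsum !big_cons big_nil /= scale1r scaleN1r scaleNr addr0 -opprD.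
by move/eqP; rewrite subr_eq0 => /eqP.
Qed.

Lemma tpair_linearr A B C c (x : P B C) (y y' : P A B) :
  tpair x (c *: y + y') = c *: tpair x y + tpair x y'.
Proof.
have := @pres_gen_respects _ _ (@bilin_rels A C) _
  (ex_intro _ B (or_intror (ex_intro _ c (ex_intro _ x
    (ex_intro _ y (ex_intro _ y' erefl)))))).
rewrite /eval_fsum !big_cons big_nil /= scale1r scaleN1r scaleNr addr0 -opprD.
by move/eqP; rewrite subr_eq0 => /eqP.
Qed.

End TensorSquare.

Section CocategoryStructure.
Variables (R : comPzRingType) (V : quiver R).

(* Deconcatenation *)
Definition comult A C : tcoc V A C -> tsquare (tcoc V) A C :=
  pres_lift (fun w : word V A C =>
    \sum_(p <- splits w) tpair (tword (tagged p).1) (tword (tagged p).2)).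

Definition counit A C : tcoc V A C -> R^o :=
  pres_lift (fun w : word V A C => if w is wnil _ then (1 : R^o) else 0).

Lemma comult_word A C (w : word V A C) :
  comult (tword w) =
  \sum_(p <- splits w) tpair (tword (tagged p).1) (tword (tagged p).2).
Proof.
rewrite /comult [tword w]/tword pres_lift_gen //; apply/mlin_respects => B D u v c x y.
rewrite !splits_cat !big_cat /= !big_map /= scalerDr addrACA !scaler_sumr.
rewrite -!big_split /=; congr (_ + _); apply: eq_bigr => p _ /=.
  by rewrite tword_mlin tpair_linearr.
by rewrite tword_mlin tpair_linearl.
Qed.

Lemma counit_word A C (w : word V A C) :
  counit (tword w) = if w is wnil _ then 1 else 0.
Proof.
rewrite /counit /tword pres_lift_gen //; apply/mlin_respects => B D u v c x y.
by clear w; case: D C / u x y => [D|D E F z u] x y /=; rewrite scaler0 addr0.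
Qed.

End CocategoryStructure.

Section CocategoryMaps.
Variables (R : comPzRingType) (V W : quiver R) (f : Ob V -> Ob W).

Definition cocmap := forall A C : V, {linear tcoc V A C -> tcoc W (f A) (f C)}.

Definition tsquare_map (Phi : cocmap) A C :
    tsquare (tcoc V) A C -> tsquare (tcoc W) (f A) (f C) :=
  pres_lift (fun p : {B : V & tcoc V B C * tcoc V A B}%type =>
    tpair (Phi _ _ (tagged p).1) (Phi _ _ (tagged p).2)).

Lemma tsquare_map_pair (Phi : cocmap) A B C (x : tcoc V B C) (y : tcoc V A B) :
  tsquare_map Phi (tpair x y) = tpair (Phi _ _ x) (Phi _ _ y).
Proof.
rewrite /tsquare_map /tpair pres_lift_gen //.
move=> r [D [[c [z [z' [t ->]]]]|[c [t [z [z' ->]]]]]];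
  rewrite /eval_fsum !big_cons big_nil /= scale1r scaleN1r scaleNr addr0 -opprD;
  apply/eqP; rewrite subr_eq0 linearP; apply/eqP.
  exact: tpair_linearl.
exact: tpair_linearr.
Qed.

Definition cocategory_morphism (Phi : cocmap) : Prop :=
  forall A C (z : tcoc V A C),
    comult (Phi A C z) = tsquare_map Phi (comult z) /\
    counit (Phi A C z) = counit z.

(* The terms of F^(x)n Delta^(n-1) on w: all words F(w_1) .. F(w_n) with
   w = w_1 .. w_n, where the w_i may be empty.  For n = 0 this is the counit. *)
Fixpoint tensor_power (F : cochain V W f) (n : nat) A C (w : word V A C) :
    seq (word W (f A) (f C)) :=
  match n with
  | 0%N => match w in word _ A C return seq (word W (f A) (f C)) with
           | wnil A => [:: wnil (f A)]
           | wcons _ _ _ _ _ => [::]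
           end
  | n'.+1 => flatten [seq
      let: existT B (u, v) := z in
      [seq wcons (F _ _ u) t | t <- tensor_power F n' v]
    | z <- splits w]
  end.

Definition component (F : cochain V W f) (n : nat) A C (w : word V A C) :
    tcoc W (f A) (f C) :=
  \sum_(v <- tensor_power F n w) tword v.

Definition extends_to (F : cochain V W f) (Phi : cocmap) : Prop :=
  cocategory_morphism Phi /\
  forall A C (w : word V A C), exists N,
    (forall n, (N <= n)%N -> component F n w = 0) /\
    Phi A C (tword w) = \sum_(n < N) component F n w.

(* The action on all arrows, objects included *)
Definition arrow_map (Phi : cocmap) (z : {p : V * V & tcoc V p.1 p.2}) :
    {p : W * W & tcoc W p.1 p.2} :=
  existT (fun p : W * W => tcoc W p.1 p.2 : Type) (f (tag z).1, f (tag z).2)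
    (Phi _ _ (tagged z)).

End CocategoryMaps.

(* The coderivation of the tensor cocategory determined by mu of degree 1 *)
Definition coderivation (R : comPzRingType) (V : quiver R) (mu : Endo V)
    (A C : V) : tcoc V A C -> tcoc V A C :=
  pres_lift (fun w : word V A C => \sum_(v <- insertions [:: (1, mu)] w) tword v).

Lemma coderivation_word (R : comPzRingType) (V : quiver R) (mu : Endo V) A C
    (w : word V A C) : (forall B D, multilinear (mu B D)) ->
  coderivation mu (tword w) = \sum_(v <- insertions [:: (1, mu)] w) tword v.
Proof.
move=> hmu; rewrite /coderivation [tword w]/tword pres_lift_gen //; apply/mlin_respects.
exact: insertions1_mlin (@tword_mlin _ _ _ _) hmu.
Qed.

(** * Morphisms of cA_infinity-categories *)

Section Morphisms.
Variables (R : comPzRingType) (a b : quiver R) (mu : CC a) (mu' : CC b).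
Variable f : Ob a -> Ob b.

Definition uncurved (F : Cochain a b f) : Prop :=
  forall A, F A A (wnil (V := qshift a) A) = 0.

(* Convergence of sum_m mu'{F_0^(x)m}: on given arguments, which lie between
   objects f(A) as F_0 does, only finitely many terms are nonzero. *)
Definition curvature_converges (F : Cochain a b f) : Prop :=
  let W := qpull (qshift b) f in
  let F0 : Endo W := zcochain (V := W) (fun A => F A A (wnil (V := qshift a) A)) in
  forall A C (w : word W A C), exists N, forall m, (N <= m)%N ->
    brace (cpull (qshift b) f mu') (nseq m (0, F0)) w = 0.

(* F is a cA_infinity-morphism, and Phi the cocategory morphism extending it *)
Definition cAinf_extension (F : Cochain a b f)
    (Phi : @cocmap R (qshift a) (qshift b) f) : Prop :=
  [/\ cAinf_structure mu /\ cAinf_structure mu',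
      hochschild 1 F,
      extends_to F Phi,
      forall A C z, Phi A C (coderivation mu z) = coderivation mu' (Phi A C z)
    & curvature_converges F].

Definition cAinf_morphism (F : Cochain a b f) : Prop :=
  exists Phi, cAinf_extension F Phi.

End Morphisms.

Definition cAinf_isomorphism (R : comPzRingType) (a b : quiver R)
    (mu : CC a) (mu' : CC b) (f : Ob a -> Ob b) (F : Cochain a b f) : Prop :=
  exists Phi (g : Ob b -> Ob a) (G : Cochain b a g) Psi,
    [/\ cAinf_extension mu mu' F Phi, cAinf_extension mu' mu G Psi,
        cancel (arrow_map Phi) (arrow_map Psi) & cancel (arrow_map Psi) (arrow_map Phi)].

Definition Ainf_isomorphism (R : comPzRingType) (a b : quiver R)
    (mu : CC a) (mu' : CC b) (f : Ob a -> Ob b) (F : Cochain a b f) : Prop :=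
  [/\ Ainf_structure mu, Ainf_structure mu', uncurved F
    & cAinf_isomorphism mu mu' F].

(** * Dual numbers *)

Section Dual.
Variable k : comPzRingType.

(* k[epsilon], the pair (x, y) being x + y epsilon *)
Definition dualnum := (k * k)%type.
HB.instance Definition _ := GRing.Zmodule.on dualnum.

Definition dual_one : dualnum := (1, 0).
Definition dual_mul (x y : dualnum) : dualnum := (x.1 * y.1, x.1 * y.2 + x.2 * y.1).

Fact dual_mulA : associative dual_mul.
Proof.
move=> [x x'] [y y'] [z z']; congr pair => /=; first by rewrite mulrA.
by rewrite mulrDr mulrDl !mulrA addrA.
Qed.
Fact dual_mulC : commutative dual_mul.
Proof.
move=> [x x'] [y y']; congr pair => /=; first by rewrite mulrC.
by rewrite addrC mulrC [x * _]mulrC.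
Qed.
Fact dual_mul1 : left_id dual_one dual_mul.
Proof. by move=> [x x']; rewrite /dual_mul /= !mul1r mul0r addr0. Qed.
Fact dual_mulDl : left_distributive dual_mul +%R.
Proof.
move=> [x x'] [y y'] [z z']; congr pair => /=; first by rewrite mulrDl.
by rewrite !mulrDl addrACA.
Qed.
HB.instance Definition _ := GRing.Zmodule_isComPzRing.Build dualnum
  dual_mulA dual_mulC dual_mul1 dual_mulDl.

Section DualModule.
Variable M : lmodType k.

(* M + M epsilon *)
Definition dual_mod := (M * M)%type.
HB.instance Definition _ := GRing.Zmodule.on dual_mod.

Definition dual_scale (c : dualnum) (x : dual_mod) : dual_mod :=
  (c.1 *: x.1, c.1 *: x.2 + c.2 *: x.1).

Fact dual_scaleA c d x : dual_scale c (dual_scale d x) = dual_scale (c * d) x.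
Proof.
case: c d x => [c c'] [d d'] [x x']; congr pair => /=; first by rewrite scalerA.
by rewrite scalerDr scalerDl !scalerA addrA.
Qed.
Fact dual_scale1 : left_id 1 dual_scale.
Proof. by move=> [x x']; rewrite /dual_scale /= !scale1r scale0r addr0. Qed.
Fact dual_scaleDr : right_distributive dual_scale +%R.
Proof.
move=> [c c'] [x x'] [y y']; congr pair => /=; first by rewrite scalerDr.
by rewrite !scalerDr addrACA.
Qed.
Fact dual_scaleDl x : {morph dual_scale^~ x : c d / c + d}.
Proof.
case: x => [x x'] [c c'] [d d']; congr pair => /=; first by rewrite scalerDl.
by rewrite !scalerDl addrACA.
Qed.
HB.instance Definition _ := GRing.Zmodule_isLmodule.Build dualnum dual_mod
  dual_scaleA dual_scale1 dual_scaleDr dual_scaleDl.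

End DualModule.

Section DualGraded.
Variable V : grmod k.

Definition dual_gpr (n : int) (x : dual_mod V) : dual_mod V :=
  (gpr V n x.1, gpr V n x.2).

Fact dual_gpr_linear n : linear (dual_gpr n).
Proof.
move=> [c c'] [x x'] [y y']; congr pair => /=; first by rewrite linearP.
by rewrite !linearD !linearZ.
Qed.
HB.instance Definition _ n :=
  GRing.isLinear.Build dualnum (dual_mod V) (dual_mod V) _ (dual_gpr n)
    (dual_gpr_linear n).

Fact dual_gprK m n x :
  dual_gpr m (dual_gpr n x) = if m == n then dual_gpr n x else 0.
Proof. by rewrite /dual_gpr /= !gprK; case: eqP. Qed.

Fact dual_gdec x : exists s : seq int, uniq s && (x == \sum_(n <- s) dual_gpr n x).
Proof.
case: x => x y; have /andP[us /eqP es] := xchooseP (gdec x).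
have /andP[ut /eqP et] := xchooseP (gdec y).
set s := xchoose (gdec x) in us es; set t := xchoose (gdec y) in ut et.
exists (undup (s ++ t)); rewrite undup_uniq /=.
have e (w : seq int) : \sum_(n <- w) dual_gpr n (x, y) =
    (\sum_(n <- w) gpr V n x, \sum_(n <- w) gpr V n y).
  by elim: w => [|n w IH]; rewrite ?big_nil // !big_cons IH.
rewrite e {1}es {1}et; apply/eqP; congr pair.
  have := gpr_sum_support (t := undup (s ++ t)) (fun=> 1) us (undup_uniq _) es.
  under eq_bigr do rewrite scale1r; under [\sum_(m <- s) _]eq_bigr do rewrite scale1r.
  by move=> -> // m hm; rewrite mem_undup mem_cat hm.
have := gpr_sum_support (t := undup (s ++ t)) (fun=> 1) ut (undup_uniq _) et.
under eq_bigr do rewrite scale1r; under [\sum_(m <- t) _]eq_bigr do rewrite scale1r.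
by move=> -> // m hm; rewrite mem_undup mem_cat hm orbT.
Qed.

Definition dual_gr : grmod dualnum :=
  @GrMod dualnum (dual_mod V) (fun n => dual_gpr n : {linear _ -> _})
    dual_gprK dual_gdec.

End DualGraded.

(* a[epsilon] = a + a epsilon *)
Definition qdual (a : quiver k) : quiver dualnum :=
  @Quiver dualnum a (fun A B => dual_gr (qhom a A B)).

Section DualWords.
Variable a : quiver k.

(* x_n .. x_1 where the letters are x_i + y_i epsilon *)
Fixpoint wbody (A C : a) (w : word (qshift (qdual a)) A C) : word (qshift a) A C :=
  match w in word _ A C return word (qshift a) A C with
  | wnil A => wnil (V := qshift a) A
  | wcons _ _ _ x w' => wcons (V := qshift a) (x : dual_mod _).1 (wbody w')
  end.

(* The words x_n .. y_i .. x_1 *)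
Fixpoint wderiv (A C : a) (w : word (qshift (qdual a)) A C) :
    seq (word (qshift a) A C) :=
  match w in word _ A C return seq (word (qshift a) A C) with
  | wnil _ => [::]
  | wcons _ _ _ x w' =>
      wcons (V := qshift a) (x : dual_mod _).2 (wbody w') ::
      [seq wcons (V := qshift a) (x : dual_mod _).1 v | v <- wderiv w']
  end.

End DualWords.

(* alpha + beta epsilon, extended k[epsilon]-multilinearly *)
Definition cdual (a b : quiver k) (f : Ob a -> Ob b) (alpha beta : Cochain a b f) :
    Cochain (qdual a) (qdual b) f :=
  fun A C w =>
    (alpha A C (wbody w), beta A C (wbody w) + \sum_(v <- wderiv w) alpha A C v).

End Dual.

(** * Full subcategories *)

Section FullSubcategory.
Variables (R : comPzRingType) (b : quiver R) (P : Ob b -> Prop).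

Definition qfull : quiver R := qpull b (fun o : {o : Ob b | P o} => sval o).

Definition cfull (phi : CC b) : CC qfull :=
  cpull (qshift b) (fun o : {o : Ob b | P o} => sval o) phi.

End FullSubcategory.
Arguments cfull {R b} P phi A C w.

Section Restriction.
Variables (R : comPzRingType) (b c : quiver R).
Variables (P : Ob b -> Prop) (Q : Ob c -> Prop) (f : Ob b -> Ob c).
Hypothesis hf : forall o, P o -> Q (f o).

Definition full_map (o : {o : Ob b | P o}) : {o : Ob c | Q o} :=
  exist _ (f (sval o)) (hf (svalP o)).

Definition crestrict (F : Cochain b c f) : Cochain (qfull P) (qfull Q) full_map :=
  fun x y w => F _ _ (wpull (V := qshift b) w).

End Restriction.

(** * Total and curvature compensating deformations *)

Section Deformations.
Variables (k : comPzRingType) (a : quiver k).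

Definition psiOb := {A : a & {x : qhom a A A | homog 1 x}}.
Definition psi_under (o : psiOb) : Ob a := projT1 o.
Definition psi_val (o : psiOb) : qhom a (psi_under o) (psi_under o) :=
  sval (projT2 o).

(* The quiver a_Psi *)
Definition qpsi : quiver k := qpull a psi_under.

Definition cpsi (phi : CC a) : CC qpsi := cpull (qshift a) psi_under phi.

Definition psi_cochain : CC qpsi := zcochain (V := qshift qpsi) psi_val.

(* The cA_infinity-structure of the total deformation a^tot_phi[epsilon] *)
Definition mu_tot (mu phi : CC a) : CC (qdual qpsi) :=
  cdual (cpsi mu)
    (fun A C w => cpsi phi w + brace (cpsi mu) [:: (0, psi_cochain)] w).

(* The objects of a^cc_phi[epsilon] *)
Definition ccOb (mu phi : CC a) (o : Ob (qdual qpsi)) : Prop :=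
  curvature (mu_tot mu phi) o = 0.

Definition zero_part (eta : CC a) (A : a) : qhom a A A := eta A A (wnil (V := qshift a) A).

Lemma zero_part_homog (eta : CC a) A : hochschild 1 eta -> homog 1 (zero_part eta A).
Proof.
by move=> /(_ A A)[_ /(_ (wnil (V := qshift a) A) 0 erefl)].
Qed.

Lemma homogB (V : grmod k) d (x y : V) : homog d x -> homog d y -> homog d (x - y).
Proof. by rewrite /homog linearB => -> ->. Qed.

Lemma homogD (V : grmod k) d (x y : V) : homog d x -> homog d y -> homog d (x + y).
Proof. by rewrite /homog linearD => -> ->. Qed.

Section Shift.
Variables (eta : CC a) (heta : hochschild 1 eta).

(* (A, psi_A) |-> (A, psi_A - eta^0_A) *)
Definition psi_shift (o : psiOb) : psiOb :=
  existT (fun A => {x : qhom a A A | homog 1 x}) (psi_under o)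
    (exist _ (psi_val o - zero_part eta (psi_under o))
       (homogB (svalP (projT2 o)) (zero_part_homog (psi_under o) heta))).

Lemma psi_shift_bij : bijective psi_shift.
Proof.
exists (fun o => existT (fun A => {x : qhom a A A | homog 1 x}) (psi_under o)
    (exist _ (psi_val o + zero_part eta (psi_under o))
       (homogD (svalP (projT2 o)) (zero_part_homog (psi_under o) heta)))).
- by case=> A [x hx]; congr existT; apply: eq_exist; rewrite /psi_val /= subrK.
- by case=> A [x hx]; congr existT; apply: eq_exist; rewrite /psi_val /= addrK.
Qed.

(* kappa_f: the Hom-modules of a_Psi at f(o), f(o') are those at o, o' *)
Definition along_shift (kappa : CC qpsi) : Cochain qpsi qpsi psi_shift :=
  fun o o' w => kappa o o' w.

(* eta' = eta - eta^0 *)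
Definition nonzero_part : CC a :=
  fun A C w => eta w - zcochain (V := qshift a) (zero_part eta) w.

(* 1_f - eta'_f epsilon *)
Definition shift_morphism : Cochain (qdual qpsi) (qdual qpsi) psi_shift :=
  cdual (along_shift (idcochain (V := qshift qpsi)))
    (fun o o' w => - along_shift (cpsi nonzero_part) w).

End Shift.

End Deformations.

(* Main.v *)
From HB Require Import structures.
Require Import Defs.
From mathcomp Require Import all_boot all_order all_algebra.
From mathcomp Require Import boolp zify.
Set Implicit Arguments.
Unset Strict Implicit.
Unset Printing Implicit Defensive.
Import GRing.Theory.
Local Open Scope ring_scope.

(** Extend eta' linearly in eps to a cochain kap of degree 0, so that the
   morphism in question is F = 1_f - eps kap with eps^2 = 0.  A product
   F(w_1) .. F(w_n) in which two factors come from eps kap vanishes, and F has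
   no zero part, so the cocategory morphism Phi that extends F is
     Phi = (relabelling of the objects along f) o (1 - eps D),
   where D is the coderivation that inserts kap at every place of a word
   (shear_power_sum).  It is a morphism of cocategories because D obeys the
   co-Leibniz rule (insum_split) and the term of second order is killed by
   eps^2 = 0 (shear_comult).

   Compatibility with codifferentials rests on one identity: for kap of degree
   0, the commutator of D with the coderivation of M is the coderivation of
   kap{M} - M{kap} (insum_commutator).  Hence Phi intertwines the codifferentials
   of M and M' as soon as
     M - f^* M' = eps (kap{M} - M{kap})
   (shear_coderivation).  For the total deformations both sides are multiples of
   eps.  Passing to f^* replaces psi by psi - eta^0, so the left side is
   eps (phi - phi' + mu{eta^0}); since phi' - phi = mu{eta} - eta{mu} and
   eta^0{mu} = 0, this equals eps (eta'{mu} - mu{eta'}), which is the right side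
   (shift_first_order).  The same commutator identity, with psi in place of kap
   and with psi{mu} = 0, shows that the total deformation squares to zero
   (mu_tot_cAinf).

   The inverse is the morphism attached in the same way to -eta, because
   (1 + eps D)(1 - eps D) = 1 (shear_cancel).  At words of length zero, the
   displayed first order relation says that f carries objects of vanishing
   curvature to objects of vanishing curvature (cc_shift); all the other data
   restrict along inclusions of object sets.  So the total and the curvature
   compensating case are two instances of one statement, in which the source
   quiver is pulled back from the target along the object map
   (shear_extension). *)

(** * Multilinear functions of words *)

Section Multilinear.
Variables (R : comPzRingType) (V : quiver R).

Lemma mlin_letter0 (M : lmodType R) A C (h : word V A C -> M) B D
    (u : word V D C) (v : word V A B) : multilinear h -> h (wcat u (wcons 0 v)) = 0.
Proof.
by move=> hh; have := hh B D u v (-1) 0 0; rewrite scaler0 add0r scaleN1r addNr.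
Qed.

Lemma mlin_head0 (M : lmodType R) A B C (h : word V A C -> M) (v : word V A B) :
  multilinear h -> h (wcons 0 v) = 0.
Proof. exact: (@mlin_letter0 _ _ _ _ _ _ (wnil C)). Qed.

Lemma mlin_wcons (M : lmodType R) A B C (h : word V A C -> M) (x : qhom V B C) :
  multilinear h -> multilinear (fun v : word V A B => h (wcons x v)).
Proof. by move=> hh D E u v c y z; rewrite (hh _ _ (wcons x u)). Qed.

Lemma mlin_head_linear (M : lmodType R) A B C (h : word V A C -> M) (v : word V A B) :
  multilinear h -> linear (fun x : qhom V B C => h (wcons x v)).
Proof. by move=> hh c x y; rewrite (hh _ _ (wnil C)). Qed.

Lemma mlin_wcatl (M : lmodType R) A B C (h : word V A C -> M) (v : word V A B) :
  multilinear h -> multilinear (fun u : word V B C => h (wcat u v)).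
Proof. by move=> hh D E u u' c x y; rewrite !wcatA; apply: hh. Qed.

Lemma mlin_wcatr (M : lmodType R) A B C (h : word V A C -> M) (u : word V B C) :
  multilinear h -> multilinear (fun v : word V A B => h (wcat u v)).
Proof. by move=> hh D E v v' c x y; rewrite -!wcatA; apply: hh. Qed.

Lemma mlinB (M : lmodType R) A C (h h' : word V A C -> M) :
  multilinear h -> multilinear h' -> multilinear (fun w => h w - h' w).
Proof. by move=> hh hh' B D u v c x y; rewrite hh hh' scalerBr opprD addrACA. Qed.

Lemma mlinZ (M : lmodType R) A C (h : word V A C -> M) r :
  multilinear h -> multilinear (fun w => r *: h w).
Proof. by move=> hh B D u v c x y; rewrite hh scalerDr !scalerA mulrC. Qed.

Lemma mlinN (M : lmodType R) A C (h : word V A C -> M) :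
  multilinear h -> multilinear (fun w => - h w).
Proof. by move=> hh B D u v c x y; rewrite hh opprD scalerN. Qed.

Lemma mlin_wpull (X : Type) (f : X -> Ob V) (M : lmodType R) A C
    (h : word V (f A) (f C) -> M) :
  multilinear h -> multilinear (fun w : word (qpull V f) A C => h (wpull w)).
Proof.
move=> hh B D u v c x y.
have e z : wpull (wcat u (wcons z v)) = wcat (wpull u) (wcons (z : qhom V _ _) (wpull v)).
  by elim: u z {x y} => //= E F G t u IH z; rewrite IH.
by rewrite !e; apply: hh.
Qed.

Lemma idcochain_mlin B D : multilinear (@idcochain R V B D).
Proof.
move=> E G u v c x y; case: G D / u x y => [D|G D D' y' u] x y /=.
  by case: B E / v x y => [K|K B E z v] x y //=; rewrite scaler0 addr0.
by case: G D / u x y y' => * /=; rewrite scaler0 addr0.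
Qed.

End Multilinear.

(** * Coderivations as sums over insertions *)

Section Insertions.
Variables (R : comPzRingType) (V : quiver R).

(** The linear extension of h composed with the coderivation of kap.  Testing
   against all h, with values in any module, makes it possible to compute with
   coderivations by induction on words. *)
Definition insum (M : lmodType R) (p : int) (kap : Endo V) A C
    (h : word V A C -> M) (w : word V A C) : M :=
  \sum_(v <- insertions [:: (p, kap)] w) h v.

(** With values in the tensor square, this is deconcatenation. *)
Definition split_sum (M : lmodType R) A C
    (g : forall B, word V B C -> word V A B -> M) (w : word V A C) : M :=
  \sum_(z <- splits w) g (tag z) (tagged z).1 (tagged z).2.

Lemma split_sum_cons (M : lmodType R) A B C
    (g : forall D, word V D C -> word V A D -> M) (x : qhom V B C) (w : word V A B) :
  split_sum g (wcons x w) =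
  g C (wnil C) (wcons x w) + split_sum (fun D u v => g D (wcons x u) v) w.
Proof. by rewrite /split_sum /= big_cons big_map. Qed.

Lemma split_sum_nil (M : lmodType R) A
    (g : forall D, word V D A -> word V A D -> M) :
  split_sum g (wnil A) = g A (wnil A) (wnil A).
Proof. by rewrite /split_sum big_seq1. Qed.

Lemma insum_nil (M : lmodType R) p kap A (h : word V A A -> M) :
  insum p kap h (wnil A) = h (wcons (kap A A (wnil A)) (wnil A)).
Proof. by rewrite /insum insertions1 !big_seq1. Qed.

Lemma insum_splits (M : lmodType R) p (kap : Endo V) A C (h : word V A C -> M) w :
  insum p kap h w = split_sum (fun B u s => split_sum (fun D v t =>
    h (wcat (wsign p u) (wcons (kap D B v) t))) s) w.
Proof. exact: insertions1. Qed.

(** Either kap is inserted at the front, with a possibly empty argument, or it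
   moves past the first letter and collects its sign. *)
Lemma insum_cons (M : lmodType R) p kap A B C (h : word V A C -> M)
    (x : qhom V B C) (w : word V A B) :
  insum p kap h (wcons x w) =
  split_sum (fun D u v => h (wcons (kap D C u) v)) (wcons x w) +
  insum p kap (fun v => h (wcons (iter `|p|%N (@gsign _ _) x) v)) w.
Proof. by rewrite /insum !insertions1 [LHS]big_cons big_map. Qed.

Lemma eq_split_sum (M : lmodType R) A C
    (g g' : forall B, word V B C -> word V A B -> M) (w : word V A C) :
  (forall B u v, g B u v = g' B u v) -> split_sum g w = split_sum g' w.
Proof. by move=> e; apply: eq_bigr. Qed.

Lemma split_sumD (M : lmodType R) A C
    (g g' : forall B, word V B C -> word V A B -> M) (w : word V A C) :
  split_sum (fun B u v => g B u v + g' B u v) w = split_sum g w + split_sum g' w.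
Proof. exact: big_split. Qed.

Lemma eq_insum (M : lmodType R) p kap A C (h h' : word V A C -> M) w :
  h =1 h' -> insum p kap h w = insum p kap h' w.
Proof. by move=> e; apply: eq_bigr => v _. Qed.

Arguments eq_insum {M p kap A C h} h' w _.
Arguments eq_split_sum {M A C g} g' w _.

Lemma insumD (M : lmodType R) p kap A C (h h' : word V A C -> M) w :
  insum p kap (fun v => h v + h' v) w = insum p kap h w + insum p kap h' w.
Proof. exact: big_split. Qed.

(** Coassociativity of deconcatenation. *)
Lemma split_sumA (M : lmodType R) A C
    (g : forall B D, word V B C -> word V D B -> word V A D -> M) (w : word V A C) :
  split_sum (fun B u v => split_sum (fun D => g B D u) v) w =
  split_sum (fun D u v => split_sum (fun B u1 u2 => g B D u1 u2 v) u) w.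
Proof.
elim: w g => [D|D B E x w IH] g; first by rewrite !split_sum_nil.
rewrite !split_sum_cons (IH (fun B D u => g B D (wcons x u))) split_sum_nil -addrA.
congr (_ + _); rewrite -split_sumD; apply: eq_split_sum => F u v.
by rewrite split_sum_cons.
Qed.

(** The co-Leibniz rule: an inserted kap lies in the left or in the right factor
   of a splitting, and in the second case it has passed the left factor. *)
Lemma insum_split (M : lmodType R) p kap A C
    (g : forall B, word V B C -> word V A B -> M) (w : word V A C) :
  insum p kap (split_sum g) w =
  split_sum (fun B u v => insum p kap (fun u' => g B u' v) u
                        + insum p kap (fun v' => g B (wsign p u) v') v) w.
Proof.
elim: w g => [D|D B E x w IH] g.
  by rewrite insum_nil split_sum_nil !insum_nil split_sum_cons split_sum_nil addrC.
pose sx := iter `|p|%N (@gsign _ _) x.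
rewrite insum_cons (eq_split_sum (fun F u v => g E (wnil E) (wcons (kap F E u) v)
   + split_sum (fun G v1 v2 => g G (wcons (kap F E u) v1) v2) v)); last first.
  by move=> F u v; rewrite split_sum_cons.
rewrite split_sumD (split_sumA (fun F G u v1 v2 => g G (wcons (kap F E u) v1) v2)).
rewrite (eq_insum (fun v => g E (wnil E) (wcons sx v)
   + split_sum (fun F u v' => g F (wcons sx u) v') v)); last first.
  by move=> v; rewrite split_sum_cons.
rewrite insumD IH /= [in RHS]split_sum_cons insum_nil insum_cons.
rewrite [X in _ + X + _ = _]split_sum_cons split_sum_nil.
rewrite (@eq_split_sum _ _ _ (fun F u v => insum p kap (fun u' => g F u' v) (wcons x u) + _)
 (fun F u v => split_sum (fun G u1 u2 => g F (wcons (kap G E u1) u2) v) (wcons x u)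
   + (insum p kap (fun u' => g F (wcons sx u') v) u
     + insum p kap (fun v' => g F (wsign p (wcons x u)) v') v))); last first.
  by move=> F u v; rewrite insum_cons addrA.
have swap (b c d e f' : M) : b + (c + d) + (e + f') = c + (b + e) + (d + f').
  by rewrite (addrCA b) -(addrA c) (addrACA b) addrA.
by rewrite !split_sumD swap.
Qed.

(** Inserting alpha in a word and then applying beta to an initial segment: by
   the co-Leibniz rule alpha ends up inside the argument of beta, which gives the
   brace beta{alpha}, or to the right of it. *)
Lemma insum_front (M : lmodType R) p (alpha beta : Endo V) A C
    (h : word V A C -> M) (w : word V A C) :
  multilinear h ->
  insum p alpha (fun v => split_sum (fun D u v => h (wcons (beta D C u) v)) v) w =
  split_sum (fun D u v => h (wcons (brace beta [:: (p, alpha)] u) v)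
     + insum p alpha (fun v' => h (wcons (beta D C (wsign p u)) v')) v) w.
Proof.
move=> hh; rewrite insum_split; apply: eq_split_sum => B u v; congr (_ + _).
pose L := GRing.isLinear.Build _ _ _ _ _ (mlin_head_linear v hh).
pose l : {linear _ -> M} := HB.pack (fun x => h (wcons x v)) L.
by rewrite /brace /insum -[RHS]/(l _) linear_sum.
Qed.

(** Two successive insertions, sorted by what happens at the front of the word:
   beta is applied to an initial segment, or alpha is and beta comes later, or
   neither touches the first letter. *)
Lemma insum2_nil (M : lmodType R) (p q : int) (alpha beta : Endo V) A (h : word V A A -> M) :
  insum p alpha (insum q beta h) (wnil A) =
  insum p alpha (fun v => split_sum (fun D u v => h (wcons (beta D A u) v)) v) (wnil A) +
  split_sum (fun D u v => insum q beta (fun v' =>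
      h (wcons (iter `|q|%N (@gsign _ _) (alpha D A u)) v')) v) (wnil A).
Proof. by rewrite insum_nil insum_cons split_sum_nil [in RHS]insum_nil. Qed.

Lemma insum2_cons (M : lmodType R) (p q : int) (alpha beta : Endo V) A B C
    (h : word V A C -> M) (x : qhom V B C) (w : word V A B) :
  insum p alpha (insum q beta h) (wcons x w) =
  insum p alpha (fun v => split_sum (fun D u v => h (wcons (beta D C u) v)) v) (wcons x w) +
  split_sum (fun D u v => insum q beta (fun v' =>
      h (wcons (iter `|q|%N (@gsign _ _) (alpha D C u)) v')) v) (wcons x w) +
  insum p alpha (insum q beta (fun v =>
      h (wcons (iter `|q|%N (@gsign _ _) (iter `|p|%N (@gsign _ _) x)) v))) w.
Proof.
rewrite [LHS]insum_cons (eq_insum _ _ (insum_cons _ _ _ _)) insumD.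
rewrite (eq_split_sum _ _ (fun D u v => insum_cons _ _ _ _ _)) split_sumD.
rewrite [X in _ = X + _ + _]insum_cons.
by rewrite addrACA !addrA.
Qed.

(** In the two orders of insertion, the terms in which alpha and kap have
   disjoint arguments agree, because kap has degree 0 and so commutes with the
   signs of alpha.  Only the nested terms remain, and these are the two braces. *)
Lemma insum_commutator (M : lmodType R) p (alpha kap : Endo V) A C
    (h : word V A C -> M) (w : word V A C) :
  (forall B D (v : word V B D), iter `|p|%N (@gsign _ _) (kap B D v) = kap B D (wsign p v)) ->
  multilinear h ->
  insum 0 kap (insum p alpha h) w - insum p alpha (insum 0 kap h) w =
  insum p (fun B D v => brace alpha [:: (0, kap)] v - brace kap [:: (p, alpha)] v) h w.
Proof.
move=> hk.
(* The commutator at the front of the word: insum_front produces the nested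
   terms, and the remaining two sums are exchanged. *)
have head A' B (y : word V A' B) (g : word V A' B -> M) : multilinear g ->
    insum 0 kap (fun v => split_sum (fun D u v => g (wcons (alpha D B u) v)) v) y +
    split_sum (fun D u v => insum p alpha (fun v' =>
      g (wcons (iter `|p|%N (@gsign _ _) (kap D B u)) v')) v) y
  = split_sum (fun D u v => g (wcons (brace alpha [:: (0, kap)] u
       - brace kap [:: (p, alpha)] u) v)) y +
    (insum p alpha (fun v => split_sum (fun D u v => g (wcons (kap D B u) v)) v) y +
    split_sum (fun D u v => insum 0 kap (fun v' => g (wcons (alpha D B u) v')) v) y).
  move=> hg; rewrite !(insum_front _ _ _ _ hg) !split_sumD addrAC !addrA.
  rewrite -[X in _ = X + _ + _]split_sumD.
  congr (_ + _); last by apply: eq_split_sum => D u v; rewrite wsign0.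
  congr (_ + _); last by apply: eq_split_sum => D u v; rewrite hk.
  apply: eq_split_sum => D u v.
  set x := brace alpha _ u; set z := brace kap _ u.
  have := mlin_head_linear v hg 1 (x - z) z.
  by rewrite !scale1r subrK.
elim: w h => [D|D B E x w IH] h hh.
  rewrite !insum2_nil /=; apply/eqP; rewrite subr_eq; apply/eqP.
  have := head _ _ (wnil D) h hh; rewrite /= => ->.
  by rewrite [in RHS]insum_nil [in LHS]split_sum_nil.
rewrite !insum2_cons head //= [in RHS]insum_cons -IH; last exact: mlin_wcons.
by rewrite opprD addrACA addrK.
Qed.

End Insertions.

(** * Linear maps on the tensor cocategory *)

Section TensorCocategoryLinear.
Variables (R : comPzRingType) (V : quiver R).

Lemma insum_mlin (M : lmodType R) p (kap : Endo V) A C (h : word V A C -> M) :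
  (forall B D, multilinear (kap B D)) -> multilinear h -> multilinear (insum p kap h).
Proof. by move=> hk hh; apply: insertions1_mlin. Qed.

Lemma brace_mlin p (alpha kap : Endo V) :
  (forall B D, multilinear (alpha B D)) -> (forall B D, multilinear (kap B D)) ->
  forall B D, multilinear (brace alpha [:: (p, kap)] (A := B) (C := D)).
Proof. by move=> ha hk B D; apply: insertions1_mlin. Qed.

Lemma tcoc_ext (M : lmodType R) A C (L L' : tcoc V A C -> M) :
  linear L -> linear L' -> (forall w, L (tword w) = L' (tword w)) -> L =1 L'.
Proof.
move=> lL lL' e z.
pose l : {linear _ -> M} := HB.pack L (GRing.isLinear.Build _ _ _ _ _ lL).
pose l' : {linear _ -> M} := HB.pack L' (GRing.isLinear.Build _ _ _ _ _ lL').
rewrite -[L z]/(l z) -[L' z]/(l' z).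
elim/pres_ind_class: z => s; rewrite fclassE !linear_sum.
by apply: eq_bigr => p _; rewrite !linearZ /=; congr (_ *: _); apply: e.
Qed.

Definition tlift (M : lmodType R) A C (h : word V A C -> M) (hh : multilinear h) :
    {linear tcoc V A C -> M} :=
  HB.pack (pres_lift (rels := @mlin_rels R V A C) h) (GRing.isLinear.Build _ _ _ _ _
    (pres_lift_linear ((mlin_respects h).1 hh))).

Lemma tlift_word (M : lmodType R) A C (h : word V A C -> M) (hh : multilinear h) w :
  tlift hh (tword w) = h w.
Proof. by rewrite /tlift /tword /= pres_lift_gen //; apply/mlin_respects. Qed.

Lemma coderivation_linear (mu : Endo V) A C :
  (forall B D, multilinear (mu B D)) -> linear (@coderivation R V mu A C).
Proof.
move=> hmu; apply: pres_lift_linear; apply/mlin_respects.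
exact: insertions1_mlin (@tword_mlin _ _ _ _) hmu.
Qed.

(** Linearity has to be proved separately for the structure maps below: each is
   induced by a function on generators, and is additive only because that
   function respects the relations. *)
Lemma comult_linear A C : linear (@comult R V A C).
Proof.
apply: pres_lift_linear; apply/mlin_respects => B D u v c x y.
rewrite !splits_cat !big_cat !big_map /= scalerDr addrACA !scaler_sumr -!big_split /=.
congr (_ + _); apply: eq_bigr => z _; first by rewrite tword_mlin tpair_linearr.
by rewrite tword_mlin tpair_linearl.
Qed.

Lemma counit_linear A C : linear (@counit R V A C).
Proof.
apply: pres_lift_linear; apply/mlin_respects => B D u v c x y.
by case: D C / u x y => [D|D E F z u] x y /=; rewrite scaler0 addr0.
Qed.

Lemma tsquare_map_linear (W : quiver R) (f : Ob V -> Ob W) (Phi : cocmap f) A C :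
  linear (@tsquare_map R V W f Phi A C).
Proof.
apply: pres_lift_linear => r [D H]; rewrite /eval_fsum.
case: H => [[c [z [z' [t ->]]]]|[c [t [z [z' ->]]]]].
  rewrite !big_cons big_nil /= linearP tpair_linearl.
  by rewrite scale1r scaleN1r scaleNr addr0 -opprD subrr.
rewrite !big_cons big_nil /= linearP tpair_linearr.
by rewrite scale1r scaleN1r scaleNr addr0 -opprD subrr.
Qed.

End TensorCocategoryLinear.

(** * Restriction along a map of objects *)

Section Pull.
Variables (R : comPzRingType) (W : quiver R) (X : Type) (f : X -> Ob W).
Local Notation V := (qpull W f).

Lemma split_sum_wpull (M : lmodType R) A C
    (g : forall B, word W B (f C) -> word W (f A) B -> M) (w : word V A C) :
  split_sum g (wpull w) =
  split_sum (fun B (u : word V B C) (v : word V A B) => g (f B) (wpull u) (wpull v)) w.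
Proof.
elim: w g => [D|D B E x w IH] g /=; first by rewrite !split_sum_nil.
by rewrite !split_sum_cons; congr (_ + _); apply: IH.
Qed.

Lemma insum_wpull (M : lmodType R) p (kap : Endo W) A C
    (h : word W (f A) (f C) -> M) (w : word V A C) :
  insum p kap h (wpull w) = insum p (cpull W f kap) (fun v : word V A C => h (wpull v)) w.
Proof.
elim: w h => [D|D B E x w IH] h /=; first by rewrite !insum_nil.
rewrite [RHS]insum_cons [LHS]insum_cons; congr (_ + _); last exact: IH.
exact: (split_sum_wpull (fun D0 u v => h (wcons (kap D0 (f E) u) v)) (wcons (V := V) x w)).
Qed.

Lemma brace_wpull p (alpha kap : Endo W) A C (w : word V A C) :
  brace alpha [:: (p, kap)] (wpull w) =
  brace (cpull W f alpha) [:: (p, cpull W f kap)] w.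
Proof. exact: (insum_wpull p kap (alpha (f A) (f C)) w). Qed.

Lemma whomog_wpull A C (w : word V A C) d : whomog w d -> whomog (wpull w) d.
Proof. by elim: w d => //= D B E x w IH d [e [hx /IH]]; exists e. Qed.

Lemma cpull_degree p (alpha : Endo W) : of_degree p alpha -> of_degree p (cpull W f alpha).
Proof.
move=> h A C; have [hm hd] := h (f A) (f C); split; first exact: mlin_wpull.
by move=> w d /whomog_wpull; apply: hd.
Qed.

End Pull.

Lemma cAinf_pull (R : comPzRingType) (c : quiver R) (X : Type) (f : X -> Ob c) (mu : CC c) :
  cAinf_structure mu ->
  cAinf_structure (a := qpull c f) (cpull (qshift c) f mu).
Proof.
move=> [hd h0]; split.
  exact: (@cpull_degree _ (qshift c) X f (2 - 1) mu hd).
move=> A C w; rewrite -[RHS](h0 _ _ (wpull (V := qshift c) w)).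
exact: esym (@brace_wpull _ (qshift c) X f 1 mu mu A C w).
Qed.

(** * Homogeneous words and signs *)

Section Signs.
Variables (R : comPzRingType) (V : quiver R).

(** Every letter is a sum of homogeneous ones, so degree conditions, which speak
   of homogeneous words only, control multilinear functions on all words. *)
Lemma homog_ext (M : lmodType R) A C (h h' : word V A C -> M) :
  multilinear h -> multilinear h' ->
  (forall w d, whomog w d -> h w = h' w) -> h =1 h'.
Proof.
move=> hh hh' e w; elim: w h h' hh hh' e => [D|D B E x w IH] h h' hh hh' e.
  exact: (e _ 0).
pose l : {linear qhom V B E -> M} := HB.pack (fun y => h (wcons y w))
  (GRing.isLinear.Build _ _ _ _ _ (mlin_head_linear w hh)).
pose l' : {linear qhom V B E -> M} := HB.pack (fun y => h' (wcons y w))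
  (GRing.isLinear.Build _ _ _ _ _ (mlin_head_linear w hh')).
have /andP[_ /eqP ex] := xchooseP (gdec x).
rewrite -[h _]/(l x) -[h' _]/(l' x) ex !linear_sum; apply: eq_bigr => n _.
apply: (IH (fun v => h (wcons (gpr _ n x) v)) (fun v => h' (wcons (gpr _ n x) v))).
- exact: mlin_wcons.
- exact: mlin_wcons.
move=> v d hv; apply: (e _ (n + d)); exists n; split; first by rewrite /homog gprK eqxx.
by rewrite addrAC subrr add0r.
Qed.

Lemma sign_absz (m n : int) : (-1) ^+ `|(m + n)%R|%N = (-1) ^+ `|m|%N * (-1) ^+ `|n|%N :> R.
Proof. by rewrite -exprD -signr_odd -[RHS]signr_odd; congr (_ ^+ _); lia. Qed.

(** The hypothesis of insum_commutator holds for cochains of degree 0: they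
   preserve the parity of homogeneous words. *)
Lemma gsign_degree0 (kap : Endo V) A C (w : word V A C) :
  of_degree 0 kap -> gsign (kap A C w) = kap A C (wsign 1 w).
Proof.
move=> hk.
have sgn_mlin (M : lmodType R) B D (h : word V B D -> M) :
    multilinear h -> multilinear (fun v => h (wsign 1 v)).
  by move=> hh E F u v c x y; rewrite !wsign_cat /= gsign_linear hh.
apply: (homog_ext (h := fun w => gsign (kap A C w)) (h' := fun w => kap A C (wsign 1 w))).
- by move=> B D u v c x y; rewrite (hk A C).1 gsign_linear.
- exact/sgn_mlin/(hk A C).1.
move=> {}w d hw; have := (hk A C).2 w d hw; rewrite addr0 => /gsign_homog ->.
have {hk} := (hk A C).1; move: (kap A C) => /=.
move: (qhom V A C : lmodType R) => M h.
elim: w M h d hw => [B|B D E x w IH] M h d /=; first by move=> -> _; rewrite scale1r.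
case=> e [hx hw] hh; rewrite (gsign_homog hx).
rewrite -[_ *: x]addr0 (mlin_head_linear _ hh) mlin_head0 // addr0.
rewrite -(IH _ (fun v => h (wcons x v)) _ hw); last exact: mlin_wcons.
by rewrite scalerA -sign_absz addrC subrK.
Qed.

End Signs.

(** * Further properties of the sums over insertions and splittings *)

Section SumLemmas.
Variables (R : comPzRingType) (V : quiver R).

Fixpoint wlen A C (w : word V A C) : nat :=
  match w with wnil _ => 0%N | wcons _ _ _ _ w' => (wlen w').+1 end.

(** The length bound is what permits induction on the right factor. *)
Lemma eq_split_sum_len (M : lmodType R) A C
    (g g' : forall B, word V B C -> word V A B -> M) (w : word V A C) :
  (forall B u v, (wlen v <= wlen w)%N -> g B u v = g' B u v) ->
  split_sum g w = split_sum g' w.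
Proof.
elim: w g g' => [D|D B E x w IH] g g' e; first by rewrite !split_sum_nil e.
rewrite !split_sum_cons e //; congr (_ + _); apply: IH => F u v hv.
by rewrite e // ltnW.
Qed.

Lemma split_sumB (M : lmodType R) A C
    (g g' : forall B, word V B C -> word V A B -> M) (w : word V A C) :
  split_sum (fun B u v => g B u v - g' B u v) w = split_sum g w - split_sum g' w.
Proof. exact: sumrB. Qed.

Lemma split_sum0 (M : lmodType R) A C (w : word V A C) :
  split_sum (fun B u v => 0 : M) w = 0.
Proof. exact: big1. Qed.

Lemma split_sumZ (M : lmodType R) A C (r : R)
    (g : forall B, word V B C -> word V A B -> M) (w : word V A C) :
  split_sum (fun B u v => r *: g B u v) w = r *: split_sum g w.
Proof. by rewrite /split_sum scaler_sumr. Qed.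

Lemma insumZ (M : lmodType R) p kap A C r (h : word V A C -> M) w :
  insum p kap (fun v => r *: h v) w = r *: insum p kap h w.
Proof. by rewrite /insum scaler_sumr. Qed.

Lemma insum0 (M : lmodType R) p kap A C (h : word V A C -> M) w :
  (forall B D (u : word V D C) (y : qhom V B D) (v : word V A B),
     h (wcat u (wcons y v)) = 0) ->
  insum p kap h w = 0.
Proof.
by move=> h0; rewrite /insum insertions1 big1 // => z _; rewrite big1 // => y _.
Qed.

Lemma linear_sub (M N : lmodType R) (L : M -> N) r x y :
  linear L -> L (x - r *: y) = L x - r *: L y.
Proof. by move=> lL; rewrite addrC -[- (r *: y)]scaleNr lL scaleNr addrC. Qed.

Lemma linear_insum (M N : lmodType R) (L : M -> N) p kap A C (h : word V A C -> M) w :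
  linear L -> L (insum p kap h w) = insum p kap (fun v => L (h v)) w.
Proof.
move=> lL; pose l : {linear M -> N} := HB.pack L (GRing.isLinear.Build _ _ _ _ _ lL).
by rewrite -[L _]/(l _) /insum linear_sum.
Qed.

Lemma linear_split (M N : lmodType R) (L : M -> N) A C
    (g : forall B, word V B C -> word V A B -> M) (w : word V A C) :
  linear L -> L (split_sum g w) = split_sum (fun B u v => L (g B u v)) w.
Proof.
move=> lL; pose l : {linear M -> N} := HB.pack L (GRing.isLinear.Build _ _ _ _ _ lL).
by rewrite -[L _]/(l _) /split_sum linear_sum.
Qed.

(** The identity cochain accepts one letter only, so a single splitting of the
   word contributes. *)
Lemma split_sum_id (M : lmodType R) A B C (h : forall D, qhom V D C -> word V A D -> M)
    (x : qhom V B C) (w : word V A B) : (forall D v, h D 0 v = 0) ->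
  split_sum (fun D u v => h D (idcochain u) v) (wcons x w) = h B x w.
Proof.
move=> h0; rewrite split_sum_cons /= h0 add0r.
case: A B / w x h h0 => [D|D B E y w] x h h0; first by rewrite split_sum_nil.
rewrite split_sum_cons /= -[RHS]addr0; congr (_ + _).
by rewrite -[RHS](@split_sum0 M _ _ w); apply: eq_split_sum => F u v /=.
Qed.

Lemma eq_insum_cochain (M : lmodType R) p (alpha beta : Endo V) A C
    (h : word V A C -> M) w :
  (forall B D (v : word V B D), alpha B D v = beta B D v) ->
  insum p alpha h w = insum p beta h w.
Proof.
move=> e; rewrite /insum !insertions1; apply: eq_bigr => z _; apply: eq_bigr => y _.
by rewrite e.
Qed.

Lemma insum_cochainDZ (M : lmodType R) p (alpha beta : Endo V) r A C
    (h : word V A C -> M) w : multilinear h ->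
  insum p (fun B D v => alpha B D v + r *: beta B D v) h w =
  insum p alpha h w + r *: insum p beta h w.
Proof.
move=> hh; rewrite /insum !insertions1 scaler_sumr -big_split; apply: eq_bigr => z _ /=.
rewrite scaler_sumr -big_split; apply: eq_bigr => y _ /=.
by rewrite [X in wcons X _]addrC hh addrC.
Qed.

Lemma insum_cochainD (M : lmodType R) p (alpha beta : Endo V) A C (h : word V A C -> M) w :
  multilinear h ->
  insum p (fun B D v => alpha B D v + beta B D v) h w =
  insum p alpha h w + insum p beta h w.
Proof.
move=> hh; rewrite -[insum p beta h w]scale1r -insum_cochainDZ //.
by apply: eq_insum_cochain => B D v; rewrite scale1r.
Qed.

Lemma insum_cochainN (M : lmodType R) p (alpha beta : Endo V) A C
    (h : word V A C -> M) w : multilinear h ->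
  (forall B D (v : word V B D), alpha B D v = - beta B D v) ->
  insum p alpha h w = - insum p beta h w.
Proof.
move=> hh e; apply/eqP; rewrite -addr_eq0 -[insum p beta h w]scale1r -insum_cochainDZ //.
apply/eqP; rewrite insum_splits.
rewrite -[RHS](@split_sum0 M _ _ w); apply: eq_split_sum => B u s.
rewrite -[RHS](@split_sum0 M _ _ s); apply: eq_split_sum => D v t.
by rewrite e scale1r addNr mlin_letter0.
Qed.

End SumLemmas.

(** * Morphisms infinitesimally close to the identity *)

(** Without zero part, every summand with at least one insertion contains the
   letter 0. *)
Lemma uncurved_converges (R : comPzRingType) (a b : quiver R) (mu' : CC b)
    (f : Ob a -> Ob b) (F : Cochain a b f) :
  (forall B D, multilinear (mu' B D)) -> uncurved F -> curvature_converges mu' F.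
Proof.
move=> hmu hF W F0 A C w; exists 1%N => -[//|m] _; rewrite /brace /=.
have zc0 E G (v : word (qpull (qshift b) f) E G) : F0 E G v = 0.
  by case: _ / v => [K|*] //=; apply: hF.
rewrite big_flatten big_map; apply: big1 => -[B [u s]] _.
rewrite big_flatten big_map; apply: big1 => -[D [v t]] _.
rewrite big_map; apply: big1 => t' _ /=.
by rewrite zc0; apply: mlin_letter0; exact: mlin_wpull.
Qed.

Section TensorPowers.
Variables (R : comPzRingType) (V W : quiver R) (f : Ob V -> Ob W).
Variable F : cochain V W f.

(** The linear extension of h applied to the n-th component of the morphism
   generated by F. *)
Definition power_sum (M : lmodType R) n A C (h : word W (f A) (f C) -> M)
    (w : word V A C) : M := \sum_(v <- tensor_power F n w) h v.

Lemma power_sumS (M : lmodType R) n A C (h : word W (f A) (f C) -> M)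
    (w : word V A C) :
  power_sum n.+1 h w =
  split_sum (fun B u v => power_sum n (fun t => h (wcons (F u) t)) v) w.
Proof.
rewrite /power_sum /= big_flatten big_map; apply: eq_bigr => -[B [u v]] _ /=.
by rewrite big_map.
Qed.

Hypothesis F0 : forall A, F (wnil A) = 0.

(** If there are more factors than letters, one factor is the value of F on an
   empty word. *)
Lemma power_sum_long (M : lmodType R) n A C (h : word W (f A) (f C) -> M)
    (w : word V A C) : multilinear h -> (wlen w < n)%N -> power_sum n h w = 0.
Proof.
elim: n A C h w => // n IH A C h w hh hn; rewrite power_sumS.
have hz B (v : word V A B) : power_sum n (fun t => h (wcons 0 t)) v = 0.
  by apply: big1 => t _; apply: mlin_head0.
case: A C / w h hh hn hz => [D|D B E x w] h hh hn hz.
  by rewrite split_sum_nil F0 hz.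
rewrite split_sum_cons F0 hz add0r -[RHS](@split_sum0 _ _ M _ _ w).
apply: eq_split_sum_len => G u v hv; apply: IH; first exact: mlin_wcons.
exact: leq_ltn_trans hv hn.
Qed.

End TensorPowers.

(** In this section the source quiver is V = f^* W, so that relabelling of objects
   is wpull, and F takes its values in the hom-modules of V. *)

Section Shear.
Variables (R : comPzRingType) (W : quiver R) (X : Type) (f : X -> Ob W).
Local Notation V := (qpull W f).
Variables (eps : R) (kap : Endo V).
Hypothesis eps_sq0 : eps * eps = 0.
Hypothesis kap_deg : of_degree 0 kap.
Hypothesis kap0 : forall A, kap (wnil A) = 0.

Let kap_mlin B D : multilinear (@kap B D) := (kap_deg B D).1.

(** Relabelling composed with 1 - eps D, where D is the coderivation of kap. *)
Definition shear_word A C (w : word V A C) : tcoc W (f A) (f C) :=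
  tword (wpull w) - eps *: insum 0 kap (fun v : word V A C => tword (wpull v)) w.

Lemma shear_word_mlin A C : multilinear (@shear_word A C).
Proof.
apply: mlinB; first exact: mlin_wpull (@tword_mlin _ _ _ _).
apply/mlinZ/insum_mlin => //; exact: mlin_wpull (@tword_mlin _ _ _ _).
Qed.

Definition shear : @cocmap R V W f := fun A C => tlift (@shear_word_mlin A C).

Lemma shearE A C (w : word V A C) : shear A C (tword w) = shear_word w.
Proof. exact: tlift_word. Qed.

Variable F : cochain V W f.
Hypothesis hF : forall A C (w : word V A C), F w = idcochain w - eps *: kap w.

Lemma shear_uncurved A : F (wnil A) = 0.
Proof. by rewrite hF kap0 scaler0 subr0. Qed.

(** The components of F add up to shear_word.  By induction on the length: split
   off the first factor F(u) = u - eps kap(u) and apply the induction hypothesis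
   to the rest; the product of the two terms of order eps vanishes. *)
Lemma shear_power_sum (M : lmodType R) N A C (h : word W (f A) (f C) -> M)
    (w : word V A C) : multilinear h -> (wlen w < N)%N ->
  \sum_(n < N) power_sum F n h w =
  h (wpull w) - eps *: insum 0 kap (fun v : word V A C => h (wpull v)) w.
Proof.
elim: N A C h w => // N IH A C h w hh hN; rewrite big_ord_recl.
have -> : \sum_(n < N) power_sum F (lift ord0 n) h w =
    split_sum (fun B (u : word V B C) (v : word V A B) =>
      \sum_(n < N) power_sum F n (fun t => h (wcons (F u) t)) v) w.
  rewrite /split_sum exchange_big /=; apply: eq_bigr => n _; exact: power_sumS.
case: A C / w h hh hN => [D|D B E x w] h hh hN.
  rewrite /power_sum /= big_seq1 split_sum_nil big1 ?addr0; last first.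
    by move=> n _; apply: big1 => t _; rewrite shear_uncurved mlin_head0.
  by rewrite insum_nil kap0 mlin_head0 // scaler0 subr0.
rewrite {1}/power_sum /= big_nil add0r.
pose hp (v : word V D E) := h (wpull v).
have hhp : multilinear hp by exact: mlin_wpull.
transitivity (split_sum (fun G u v => hp (wcons (idcochain u) v)
  - eps *: hp (wcons (kap u) v)
  - eps *: insum 0 kap (fun v' => hp (wcons (idcochain u) v')) v) (wcons x w)).
  rewrite !split_sum_cons shear_uncurved [idcochain _]/(0 : qhom V E E) kap0.
  congr (_ + _).
    rewrite !mlin_head0 // scaler0 !subr0 [insum _ _ _ _]big1 ?scaler0 ?subr0.
      by apply: big1 => n _; apply: big1 => t _; apply: mlin_head0.
    by move=> t _; apply: mlin_head0.
  apply: eq_split_sum_len => G u v hv.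
  set y := F (wcons x u).
  set z : qhom W (f G) (f E) := idcochain (wcons x u).
  set t : qhom W (f G) (f E) := kap (wcons x u).
  have hy s : h (wcons y s) = h (wcons z s) - eps *: h (wcons t s).
    rewrite /y hF -/z -/t addrC -scaleNr (mlin_head_linear _ hh (- eps) t z).
    by rewrite scaleNr addrC.
  rewrite (IH _ _ (fun t' => h (wcons y t'))); last 2 first.
  - exact: mlin_wcons.
  - exact: leq_ltn_trans hv hN.
  rewrite hy; congr (_ - _).
  rewrite (@eq_insum _ _ M 0 kap _ _ _ _ v (fun v' : word V D G => hy (wpull v'))).
  rewrite /insum sumrB -scaler_sumr scalerBr scalerA eps_sq0 scale0r subr0.
  by [].
rewrite !split_sumB !split_sumZ insum_cons scalerDr opprD addrA.
congr (_ - _ - eps *: _).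
  by apply: (@split_sum_id _ _ _ _ _ _ (fun G y v => hp (wcons y v))) => G v; apply: mlin_head0.
apply: (@split_sum_id _ _ _ _ _ _ (fun G y v => insum 0 kap (fun v' => hp (wcons y v')) v)).
by move=> G v; apply: big1 => t _; apply: mlin_head0.
Qed.

Lemma shear_counit A C (z : tcoc V A C) : counit (shear A C z) = counit z.
Proof.
apply: (tcoc_ext (L := fun z => counit (shear A C z))) => [c x y||w].
- by rewrite linearP; apply: counit_linear.
- exact: counit_linear.
rewrite shearE counit_word /shear_word linear_sub; last exact: counit_linear.
rewrite linear_insum ?insum0; last exact: counit_linear.
  by rewrite scaler0 subr0 counit_word; case: _ / w.
by move=> B D u y v; rewrite counit_word; case: _ / u y.
Qed.

(** The co-Leibniz rule says that 1 - eps D is comultiplicative up to the term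
   eps^2 (D (x) D), which vanishes. *)
Lemma shear_comult A C (z : tcoc V A C) :
  comult (shear A C z) = tsquare_map shear (comult z).
Proof.
apply: (tcoc_ext (L := fun z => comult (shear A C z))
                 (L' := fun z => tsquare_map shear (comult z))) => [c x y|c x y|w].
- by rewrite linearP; apply: comult_linear.
- by rewrite comult_linear (@tsquare_map_linear R V W f shear A C).
rewrite shearE comult_word /shear_word linear_sub; last exact: comult_linear.
rewrite linear_insum; last exact: comult_linear.
pose T B (u : word V B C) (v : word V A B) := tpair (tword (wpull u)) (tword (wpull v)).
have e v : comult (tword (wpull v)) = split_sum T v.
  rewrite comult_word.
  exact: (split_sum_wpull (fun B u v => tpair (tword u) (tword v)) v).
rewrite e (@eq_insum _ _ _ _ _ _ _ _ _ w e) insum_split.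
rewrite -[X in tsquare_map _ X]/(split_sum (fun B u v => tpair (tword u) (tword v)) w).
rewrite (linear_split (L := @tsquare_map R V W f shear A C)); last first.
  exact: (@tsquare_map_linear R V W f shear A C).
rewrite -split_sumZ -split_sumB; apply: eq_split_sum => B u v.
rewrite tsquare_map_pair !shearE /shear_word wsign0.
have ll b : linear (fun a => tpair (P := tcoc W) (A := f A) (B := f B) (C := f C) a b).
  by move=> c x y; apply: tpair_linearl.
have lr a : linear (fun b => tpair (P := tcoc W) (A := f A) (B := f B) (C := f C) a b).
  by move=> c x y; apply: tpair_linearr.
rewrite (linear_sub _ _ _ (ll _)) !(linear_sub _ _ _ (lr _)) scalerBr scalerA eps_sq0.
rewrite scale0r subr0 scalerDr opprD.
rewrite (linear_insum _ _ _ _ (ll _)) (linear_insum _ _ _ _ (lr _)).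
by rewrite addrA addrAC.
Qed.

Lemma shear_extends : extends_to F shear.
Proof.
split=> [A C z|A C w]; first by split; [exact: shear_comult | exact: shear_counit].
exists (wlen w).+1; split=> [n hn|].
  exact: (@power_sum_long _ _ _ _ _ shear_uncurved _ n _ _ _ w (@tword_mlin _ _ _ _) hn).
rewrite shearE; exact: (esym (shear_power_sum (@tword_mlin _ _ _ _) (ltnSn _))).
Qed.

Lemma shear_degree : of_degree 0 F.
Proof.
move=> A C; split=> [|w d hw].
  move=> B D u v c x y; rewrite !hF.
  exact: (mlinB (@idcochain_mlin R V A C) (mlinZ eps (@kap_mlin A C)) u v c x y).
rewrite hF /homog linearB linearZ (kap_deg A C).2 //; congr (_ - _).
case: A C / w hw => [D|D B E x w] /=; first by rewrite linear0.
case=> e [hx hw]; case: D B / w x hx hw => [D|D B B' y w] x hx /=; last by rewrite linear0.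
by move/eqP; rewrite subr_eq0 => /eqP ->; rewrite addr0.
Qed.

Variables (M : Endo V) (M' : Endo W).
Hypotheses (hM : of_degree 1 M) (hM' : of_degree 1 M').
Hypothesis hMM' : forall A C (w : word V A C),
  M w - M' (wpull w) = eps *: (brace kap [:: (1, M)] w - brace M [:: (0, kap)] w).

(** By the commutator identity the hypothesis on M - f^* M' reads
   D_M - D_(f^* M') = eps [D, D_M], and then (1 - eps D) D_M and
   D_(f^* M') (1 - eps D) differ by a multiple of eps^2. *)
Lemma shear_coderivation A C (z : tcoc V A C) :
  shear A C (coderivation M z) = coderivation M' (shear A C z).
Proof.
have M_mlin B D : multilinear (@M B D) := (hM B D).1.
have M'_mlin B D : multilinear (@M' B D) := (hM' B D).1.
apply: (tcoc_ext (L := fun z => shear A C (coderivation M z))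
                 (L' := fun z => coderivation M' (shear A C z))) => [c x y|c x y|w].
- by rewrite coderivation_linear // linearP.
- by rewrite linearP coderivation_linear.
pose h (v : word V A C) := tword (wpull v).
have hh : multilinear h by exact: mlin_wpull (@tword_mlin _ _ _ _).
pose gam : Endo V := fun B D v => brace M [:: (0, kap)] v - brace kap [:: (1, M)] v.
have eM B D (v : word V B D) : cpull W f M' _ _ v = M v + eps *: gam B D v.
  by rewrite /gam -opprB scalerN -hMM' opprB addrC subrK.
have codM' v : coderivation M' (h v) = insum 1 M h v + eps *: insum 1 gam h v.
  rewrite coderivation_word // -/(insum 1 M' (@tword R W (f A) (f C)) (wpull v)) insum_wpull.
  by rewrite (eq_insum_cochain _ _ _ eM) insum_cochainDZ.
have hk B D (v : word V B D) :
    iter `|1%Z|%N (@gsign _ _) (kap v) = @kap B D (wsign 1 v).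
  exact: gsign_degree0.
have shM : shear A C (coderivation M (tword w)) =
    insum 1 M h w - eps *: insum 1 M (insum 0 kap h) w.
  rewrite coderivation_word // -/(insum 1 M (@tword R V A C) w).
  rewrite (linear_insum _ _ _ _ (linearP (shear A C))).
  rewrite (@eq_insum _ _ _ _ _ _ _ _ (fun v => h v - eps *: insum 0 kap h v) w (@shearE A C)).
  by rewrite /insum sumrB -scaler_sumr.
have lin := @coderivation_linear _ _ M' (f A) (f C) M'_mlin.
rewrite shM shearE /shear_word -/(h w) -/(insum 0 kap h w) (linear_sub _ _ _ lin).
rewrite (linear_insum _ _ _ _ lin) codM' (@eq_insum _ _ _ _ _ _ _ _ _ w codM').
rewrite insumD insumZ scalerDr scalerA eps_sq0 scale0r addr0.
rewrite -(@insum_commutator _ _ _ 1 M kap _ _ h w hk hh).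
by rewrite scalerBr addrA addrAC addrK.
Qed.

End Shear.

(** The criterion for morphisms of the form 1_f - eps kap, applied below to the
   total and to the curvature compensating deformations. *)
Lemma shear_extension (R : comPzRingType) (c : quiver R) (X : Type) (f : X -> Ob c)
    (eps : R) (kap : CC (qpull c f)) (kap_deg : of_degree 0 kap)
    (M : CC (qpull c f)) (M' : CC c) (F : Cochain (qpull c f) c f) :
  eps * eps = 0 -> (forall A, kap A A (wnil (V := qshift (qpull c f)) A) = 0) ->
  cAinf_structure M -> cAinf_structure M' ->
  (forall A C w, M A C w - M' _ _ (wpull (V := qshift c) w) =
     eps *: (brace kap [:: (1, M)] w - brace M [:: (0, kap)] w)) ->
  (forall A C w, F A C w = idcochain (V := qshift (qpull c f)) w - eps *: kap A C w) ->
  cAinf_extension M M' F (shear (W := qshift c) eps kap_deg).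
Proof.
move=> eps_sq0 k0 hM hM' hMM' hF; split=> //.
- exact: (@shear_degree R (qshift c) X f eps kap kap_deg F hF).
- exact: (@shear_extends R (qshift c) X f eps kap eps_sq0 kap_deg k0 F hF).
- exact: (@shear_coderivation R (qshift c) X f eps kap eps_sq0 kap_deg M M' hM.1 hM'.1 hMM').
apply: uncurved_converges; first by move=> B D; exact: (hM'.1 B D).1.
by move=> A; exact: (@shear_uncurved R (qshift c) X f eps kap k0 F hF).
Qed.

(** * Cochains over the dual numbers *)

Section DualCalculus.
Variables (k : comPzRingType) (a : quiver k).
Local Notation DV := (qshift (qdual a)).
Local Notation V := (qshift a).

Definition dual_eps : dualnum k := (0, 1).

Lemma dual_eps_sq0 : dual_eps * dual_eps = 0.
Proof. by congr pair => /=; rewrite ?mul0r ?mulr0 ?addr0. Qed.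

Lemma dual_scaleE (M : lmodType k) (c : dualnum k) (x : dual_mod M) :
  c *: x = (c.1 *: x.1, c.1 *: x.2 + c.2 *: x.1).
Proof. by []. Qed.

Lemma eps_scale (M : lmodType k) (x y : M) : dual_eps *: ((x, y) : dual_mod M) = (0, x).
Proof. by rewrite dual_scaleE /= !scale0r add0r scale1r. Qed.

Fixpoint wpure (A C : a) (w : word V A C) : word DV A C :=
  match w in word _ A C return word DV A C with
  | wnil A => wnil (V := DV) A
  | wcons _ _ _ x w' => wcons (V := DV) ((x, 0) : dual_mod _) (wpure w')
  end.

(** Since x + y eps is an eps-combination of letters without eps, multilinear
   functions over the dual numbers are determined by words of such letters; on
   these, cochains of the form cdual are pairs of cochains. *)
Lemma wpure_ext (M : lmodType (dualnum k)) A C (h h' : word DV A C -> M) :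
  multilinear h -> multilinear h' ->
  (forall w, h (wpure w) = h' (wpure w)) -> h =1 h'.
Proof.
move=> hh hh' e w; elim: w h h' hh hh' e => [D|D B E x w IH] h h' hh hh' e.
  exact: (e (wnil (V := V) D)).
case: x => x y.
have -> : ((x, y) : dual_mod (qhom a B E)) =
   dual_eps *: ((y, 0) : dual_mod (qhom a B E)) + ((x, 0) : dual_mod (qhom a B E)).
  by rewrite eps_scale; congr pair; rewrite ?add0r ?addr0.
rewrite (mlin_head_linear (C := E) w hh dual_eps) (mlin_head_linear (C := E) w hh' dual_eps).
have st z : h (wcons (V := DV) ((z, 0) : dual_mod (qhom a B E)) w) =
            h' (wcons (V := DV) ((z, 0) : dual_mod (qhom a B E)) w).
  apply: (IH (fun v => h (wcons (V := DV) _ v)) (fun v => h' (wcons (V := DV) _ v))).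
  - exact: mlin_wcons.
  - exact: mlin_wcons.
  by move=> v; exact: (e (wcons (V := V) z v)).
by congr (_ *: _ + _); apply: st.
Qed.

Lemma wbody_cat A B C (u : word DV B C) (v : word DV A B) :
  wbody (wcat u v) = wcat (wbody u) (wbody v).
Proof. by elim: u v => //= D E F x u IH v; rewrite IH. Qed.

Lemma wderiv_cat A B C (u : word DV B C) (v : word DV A B) :
  wderiv (wcat u v) = [seq wcat s (wbody v) | s <- wderiv u] ++
                      [seq wcat (wbody u) s | s <- wderiv v].
Proof.
elim: u v => [D|D E F x u IH] v /=; first by rewrite map_id.
by rewrite IH wbody_cat map_cat -!map_comp.
Qed.

Lemma wbody_pure A C (w : word V A C) : wbody (wpure w) = w.
Proof. by elim: w => //= D E F x w ->. Qed.

Lemma wderiv_pure (M : lmodType k) A C (h : word V A C -> M) (w : word V A C) :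
  multilinear h -> \sum_(v <- wderiv (wpure w)) h v = 0.
Proof.
elim: w h => [D|D B E x w IH] h hh; first by rewrite /= big_nil.
rewrite /= big_cons big_map mlin_head0 // add0r; apply: IH; exact: mlin_wcons.
Qed.

Lemma wsign_pure p A C (w : word V A C) : wsign p (wpure w) = wpure (wsign p w).
Proof.
have gs B D (x : qhom V B D) :
    gsign (V := qhom DV B D) ((x, 0) : dual_mod _) = ((gsign x, 0) : dual_mod _).
  have /andP[us /eqP es] := xchooseP (gdec x).
  have e (c : int -> dualnum k) (s : seq int) : (forall m, (c m).2 = 0) ->
     \sum_(m <- s) c m *: gpr (qhom DV B D) m ((x, 0) : dual_mod _)
     = ((\sum_(m <- s) (c m).1 *: gpr _ m x, 0) : dual_mod _).
    move=> hc; elim: s => [|m s IH]; first by rewrite !big_nil.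
    rewrite !big_cons IH dual_scaleE hc; congr pair => /=.
    by rewrite linear0 scaler0 scale0r !addr0.
  have sgn n : (-1) ^+ n = ((-1) ^+ n, 0) :> dualnum k.
    elim: n => [|n IH]; first by rewrite !expr0.
    by rewrite !exprS IH; congr pair; rewrite /= ?mulr0 ?oppr0 ?mul0r ?addr0.
  rewrite (gsignE us).
    rewrite e => [|m]; last by rewrite sgn.
    by congr pair; rewrite [RHS](gsignE us es); apply: eq_bigr => m _; rewrite sgn.
  transitivity (\sum_(m <- xchoose (gdec x))
      (1 : dualnum k) *: gpr (qhom DV B D) m ((x, 0) : dual_mod _)).
    rewrite (e (fun=> 1)) //; congr pair.
    by rewrite {1}es; apply: eq_bigr => m _; rewrite scale1r.
  by apply: eq_bigr => m _; rewrite scale1r.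
elim: w => //= D E F x w ->; congr wcons.
by elim: `|p|%N => //= n ->; rewrite gs.
Qed.

Lemma whomog_body A C (w : word DV A C) d : whomog w d -> whomog (wbody w) d.
Proof.
elim: w d => //= D B E x w IH d [e [hx /IH hw]]; exists e; split=> //.
by move: hx; rewrite /homog => {2}<-.
Qed.

Variables (b : quiver k) (f : Ob a -> Ob b).
Implicit Types alpha beta : Cochain a b f.

Lemma cdual_mlin alpha beta :
  (forall A C, multilinear (alpha A C)) -> (forall A C, multilinear (beta A C)) ->
  forall A C, multilinear (cdual alpha beta (A := A) (C := C)).
Proof.
move=> ha hb A C B D u v c x y.
rewrite /cdual !wbody_cat !wderiv_cat !big_cat !big_map /= !big_cons !big_map.
rewrite dual_scaleE; congr pair => /=; first exact: ha.
have comb (M : zmodType) (b1 s1 a2 t1 a1 b2 s2 a3 t2 : M) :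
  b1 + b2 + (s1 + s2 + (a2 + (a1 + a3) + (t1 + t2))) =
  b1 + (s1 + (a2 + t1)) + a1 + (b2 + (s2 + (a3 + t2))).
  rewrite (addrACA a2) (addrACA s1) (addrACA b1) -[RHS]addrA; congr (_ + _).
  by rewrite -(addrA a1) (addrCA s2) (addrCA b2).
rewrite -[c.1 *: _ + c.2 *: _ + _]addrA !ha hb.
rewrite (eq_bigr _ (fun s _ => ha _ _ _ _ s _ _ _ _)) big_split -scaler_sumr /=.
rewrite (eq_bigr _ (fun s _ => ha _ _ _ _ _ s _ _ _)) big_split -scaler_sumr /=.
by rewrite comb !scalerDr.
Qed.

Lemma homog_dual d (V' : grmod k) (x : dual_mod V') :
  homog d x.1 -> homog d x.2 -> homog (V := dual_gr V') d x.
Proof. by case: x => x y; rewrite /homog /= => h1 h2; congr pair. Qed.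

Lemma wderiv_homog (M : grmod k) A C (h : word V A C -> M) (w : word DV A C) d e :
  (forall v, whomog v d -> homog e (h v)) -> whomog w d ->
  homog e (\sum_(v <- wderiv w) h v).
Proof.
elim: w h d => [D|D B E x w IH] h d hh /=; first by rewrite big_nil /homog linear0.
case=> n [hx hw]; rewrite big_cons big_map.
have [h1 h2] : homog (V := qhom V B E) n x.1 /\ homog (V := qhom V B E) n x.2.
  by split; [exact: (congr1 fst hx) | exact: (congr1 snd hx)].
apply: homogD; first by apply: hh; exists n; split=> //; apply: whomog_body.
by apply: (IH (fun v => h (wcons (V := V) x.1 v)) _ _ hw) => v hv; apply: hh; exists n.
Qed.

Lemma cdual_degree p alpha beta :
  of_degree p alpha -> of_degree p beta -> of_degree p (cdual alpha beta).
Proof.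
move=> ha hb A C; split=> [|w d hw].
  by apply: cdual_mlin => B D; [exact: (ha B D).1 | exact: (hb B D).1].
have [_ ha'] := ha A C; have [_ hb'] := hb A C; have hw' := whomog_body hw.
apply: (@homog_dual (d + p) (gshift (qhom b (f A) (f C)))); first exact: ha'.
apply: homogD; first exact: hb'.
by apply: wderiv_homog hw => v; apply: ha'.
Qed.

Lemma cdual_pure alpha beta A C (w : word V A C) :
  multilinear (alpha A C) -> cdual alpha beta (wpure w) = (alpha A C w, beta A C w).
Proof. by move=> ha; rewrite /cdual wbody_pure wderiv_pure // addr0. Qed.

End DualCalculus.

Section DualBraces.
Variables (k : comPzRingType) (a : quiver k).
Local Notation DV := (qshift (qdual a)).
Local Notation V := (qshift a).
Implicit Types alpha beta gam del : CC a.

Let mlin alpha := forall A C, multilinear (alpha A C).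

Lemma split_sum_pure (M : lmodType (dualnum k)) A C
    (g : forall B, word DV B C -> word DV A B -> M) (w : word V A C) :
  split_sum g (wpure w) =
  \sum_(z <- splits w) g (tag z) (wpure (tagged z).1) (wpure (tagged z).2).
Proof.
elim: w g => [D|D B E x w IH] g /=; first by rewrite split_sum_nil big_seq1.
by rewrite split_sum_cons big_cons big_map; congr (_ + _); apply: IH.
Qed.

Lemma sum_pair (M : lmodType k) I (s : seq I) (g h : I -> M) :
  \sum_(i <- s) ((g i, h i) : dual_mod M) = (\sum_(i <- s) g i, \sum_(i <- s) h i).
Proof. by elim: s => [|i s IH]; rewrite ?big_nil // !big_cons IH. Qed.

(** Braces over the dual numbers follow the product rule
   (alpha + beta eps){gam + del eps} =
   alpha{gam} + (beta{gam} + alpha{del}) eps. *)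
Lemma brace_cdual p alpha beta gam del A C (w : word DV A C) :
  mlin alpha -> mlin beta -> mlin gam -> mlin del ->
  brace (cdual alpha beta) [:: (p, cdual gam del)] w =
  cdual (fun A C w => brace alpha [:: (p, gam)] w)
    (fun A C w => brace beta [:: (p, gam)] w + brace alpha [:: (p, del)] w) w.
Proof.
move=> ha hb hg hd; move: w; apply: wpure_ext => [||w].
- by apply: (brace_mlin (V := DV)); apply: cdual_mlin.
- apply: cdual_mlin => B D; first exact: (brace_mlin (V := V)).
  move=> E F u v c x y; rewrite !(brace_mlin (V := V)) //.
  by rewrite scalerDr addrACA.
rewrite cdual_pure; last exact: (brace_mlin (V := V)).
rewrite [LHS](insum_splits (V := DV)) split_sum_pure.
have e (B D : V) (u : word V B C) (v : word V D B) (t : word V A D) :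
    cdual alpha beta (wcat (wsign p (wpure u))
      (wcons (V := DV) (cdual gam del (wpure v)) (wpure t))) =
    (alpha _ _ (wcat (wsign p u) (wcons (V := V) (gam D B v) t)),
     beta _ _ (wcat (wsign p u) (wcons (V := V) (gam D B v) t)) +
     alpha _ _ (wcat (wsign p u) (wcons (V := V) (del D B v) t))).
  rewrite (cdual_pure _ _ (hg _ _)) wsign_pure /cdual wbody_cat wderiv_cat.
  rewrite big_cat !big_map /= big_cons big_map !wbody_pure.
  rewrite wderiv_pure; last exact: (mlin_wcatl (V := V)).
  rewrite (wderiv_pure _ (h := fun j => alpha _ _ (wcat _ (wcons (V := V) _ j)))).
    by rewrite addr0 add0r.
  exact: (mlin_wcons (V := V) (gam D B v) (mlin_wcatr (V := V) (wsign p u) (ha A C))).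
rewrite (eq_bigr (fun z : {B : V & word V B C * word V A B}%type =>
  (split_sum (fun D v t => alpha _ _ (wcat (wsign p (tagged z).1)
      (wcons (V := V) (gam D (tag z) v) t))) (tagged z).2,
   split_sum (fun D v t => beta _ _ (wcat (wsign p (tagged z).1)
      (wcons (V := V) (gam D (tag z) v) t))
     + alpha _ _ (wcat (wsign p (tagged z).1)
      (wcons (V := V) (del D (tag z) v) t))) (tagged z).2) : dual_mod _)); last first.
  move=> [B [u s]] _ /=; rewrite split_sum_pure -sum_pair; apply: eq_bigr => -[D [v t]] _.
  exact: e.
rewrite sum_pair; congr pair; first by rewrite [RHS](insum_splits (V := V)).
rewrite /brace -!/(insum _ _ _ _) !(insum_splits (V := V)) -split_sumD.
by apply: eq_bigr => z _; rewrite split_sumD.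
Qed.

Lemma cdual_id A C (w : word DV A C) (th : CC a) :
  mlin th ->
  cdual (@idcochain k V) (fun A C w => - th A C w) w =
  idcochain (V := DV) w - (dual_eps k) *: cdual th (fun A C w => 0) w.
Proof.
move=> ht; have m0 B D : multilinear (fun _ : word V B D => 0 : qhom V B D).
  by move=> E F u v c x y; rewrite scaler0 addr0.
move: w; apply: wpure_ext => [||w].
- apply: cdual_mlin => B D; first exact: idcochain_mlin.
  exact: (mlinN (V := V)).
- apply: mlinB; first exact: idcochain_mlin.
  by apply: mlinZ; apply: cdual_mlin.
rewrite !cdual_pure //; last exact: idcochain_mlin.
have -> : idcochain (V := DV) (wpure w) = ((idcochain (V := V) w, 0) : dual_mod _).
  by case: A C / w => [A|A B C x w] //; case: A B / w x.
rewrite eps_scale -[RHS]/((idcochain (V := V) w - 0, 0 - th A C w) : dual_mod _).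
by rewrite subr0 sub0r.
Qed.

End DualBraces.

(** * Degrees of braces *)

Section BraceDegree.
Variables (R : comPzRingType) (V : quiver R).

Lemma whomog_cat A B C (u : word V B C) (v : word V A B) d e :
  whomog u d -> whomog v e -> whomog (wcat u v) (d + e).
Proof.
elim: u v d => [D|D E F x u IH] v d /=; first by move=> ->; rewrite add0r.
case=> n [hx hu] hv; exists n; split=> //.
by rewrite addrAC; apply: IH.
Qed.

Lemma iter_gsign_homog (U : grmod R) n d (x : U) :
  homog d x -> homog d (iter n (@gsign R U) x).
Proof.
move=> hx; elim: n => //= n IH; rewrite (gsign_homog IH) /homog linearZ.
by rewrite IH.
Qed.

Lemma whomog_sign p A C (w : word V A C) d : whomog w d -> whomog (wsign p w) d.
Proof.
elim: w d => //= D E F x w IH d [e [hx /IH hw]]; exists e; split=> //.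
exact: iter_gsign_homog.
Qed.

Lemma split_sum_homog (U : grmod R) A C e d
    (g : forall B, word V B C -> word V A B -> U) (w : word V A C) :
  (forall B u v d1 d2, whomog u d1 -> whomog v d2 -> d1 + d2 = d -> homog e (g B u v)) ->
  whomog w d -> homog e (split_sum g w).
Proof.
elim: w d g => [D|D B E x w IH] d g hg.
  by rewrite split_sum_nil /= => d0; apply: (hg _ _ _ 0 0) => //; rewrite d0.
move=> hw; rewrite split_sum_cons; apply: homogD.
  by apply: (hg _ _ _ 0 d) => //; rewrite add0r.
case: hw => n [hx hw].
apply: (IH (d - n) (fun D u v => g D (wcons x u) v)) => // F u v d1 d2 hu hv hd.
apply: (hg _ _ _ (n + d1) d2) => //; last by rewrite -addrA hd addrC subrK.
by exists n; rewrite addrAC subrr add0r.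
Qed.

Lemma brace_degree p q r (alpha kap : Endo V) :
  of_degree p alpha -> of_degree q kap ->
  of_degree (q + p) (fun A C w => brace alpha [:: (r, kap)] (A := A) (C := C) w).
Proof.
move=> ha hk A C; split=> [|w d hw].
  apply: brace_mlin => B D; [exact: (ha B D).1 | exact: (hk B D).1].
rewrite [brace _ _ _](insum_splits r kap (alpha A C)).
apply: split_sum_homog hw => B u s d1 d2 hu hs hd.
apply: split_sum_homog hs => D v t d3 d4 hv ht hd2.
rewrite addrA; apply: (ha A C).2; rewrite -hd -hd2 -addrA.
apply: whomog_cat; first exact: whomog_sign.
exists (d3 + q); split; first exact: (hk D B).2.
by rewrite (_ : _ - _ = d4) //; lia.
Qed.

Lemma zcochain_degree p (c : forall A : V, qhom V A A) :
  (forall A, homog p (c A)) -> of_degree p (zcochain c).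
Proof.
move=> hc A C; split=> [B D u v s x y|w d].
  by case: D C / u x y => * /=; rewrite scaler0 addr0.
case: A C / w => [A|A B C x w] /=; last by move=> _; rewrite /homog linear0.
by move=> ->; rewrite add0r.
Qed.

Lemma degreeD p (alpha beta : Endo V) : of_degree p alpha -> of_degree p beta ->
  of_degree p (fun A C w => alpha A C w + beta A C w).
Proof.
move=> ha hb A C; split=> [B D u v c x y|w d hw].
  by rewrite (ha A C).1 (hb A C).1 scalerDr addrACA.
by apply: homogD; [apply: (ha A C).2 | apply: (hb A C).2].
Qed.

Lemma degreeN p (alpha : Endo V) : of_degree p alpha ->
  of_degree p (fun A C w => - alpha A C w).
Proof.
move=> ha A C; split=> [B D u v c x y|w d hw].
  by rewrite (ha A C).1 opprD scalerN.
by rewrite /homog linearN (ha A C).2.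
Qed.

(** A brace is evaluated on words with at least one letter, where a cochain
   concentrated in the zero part vanishes. *)
Lemma brace_zcochain p (c : forall A : V, qhom V A A) (alpha : Endo V) A C (w : word V A C) :
  brace (zcochain c) [:: (p, alpha)] w = 0.
Proof.
by apply: (@insum0 _ _ _ p alpha _ _ (@zcochain R V c A C)) => B D u y v; case: _ / u y.
Qed.

End BraceDegree.

(** * Inverse morphisms *)

(** The two object maps compose to the identity only up to a propositional
   equality, so arrows before and after are compared as dependent pairs with
   their end points. *)

Section Cancellation.

Lemma existT_inj (T : Type) (P : T -> Type) (x : T) (y y' : P x) :
  existT P x y = existT P x y' -> y = y'.
Proof. by move=> e; have := projT2_eq e; rewrite (Prop_irrelevance (projT1_eq e) erefl). Qed.

Variables (R : comPzRingType).

Definition words (V : quiver R) (p : V * V) : Type := word V p.1 p.2.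
Definition arrows (V : quiver R) (p : V * V) : Type := qhom V p.1 p.2.
Definition tarrows (V : quiver R) (p : V * V) : Type := tcoc V p.1 p.2.

(** A relabelling acts letter by letter, so it suffices to compare letters. *)
Lemma word_transport (V : quiver R) (h : V -> V)
    (L : forall A C, qhom V A C -> qhom V (h A) (h C))
    (r : forall A C, word V A C -> word V (h A) (h C)) :
  (forall A, h A = A) ->
  (forall A C x, existT (@arrows V) (h A, h C) (L A C x) = existT (@arrows V) (A, C) x) ->
  (forall A, r A A (wnil A) = wnil (h A)) ->
  (forall A B C x (w : word V A B), r A C (wcons x w) = wcons (L B C x) (r A B w)) ->
  forall A C w, existT (@words V) (h A, h C) (r A C w) = existT (@words V) (A, C) w.
Proof.
move=> hid hL rnil rcons A C w; elim: w => [D|D B E x w IH].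
  by rewrite rnil hid.
rewrite rcons; move: (hL B E x) IH; move: (L B E x) (r D B w).
move: (hid D) (hid B) (hid E); move: (h D) (h B) (h E) => D' B' E' -> -> -> x' w'.
by move=> hx hw'; rewrite (existT_inj hx) (existT_inj hw').
Qed.

Lemma tcoc_transport (V : quiver R) (A C A' C' : V) (r : word V A C -> word V A' C')
    (L : tcoc V A C -> tcoc V A' C') (z : tcoc V A C) :
  A' = A -> C' = C -> linear L -> (forall w, L (tword w) = tword (r w)) ->
  (forall w, existT (@words V) (A', C') (r w) = existT (@words V) (A, C) w) ->
  existT (@tarrows V) (A', C') (L z) = existT (@tarrows V) (A, C) z.
Proof.
move=> eA eC; move: r L; rewrite eA eC => r L lL e hr.
rewrite (_ : L z = z) //; move: z; apply: (tcoc_ext (L' := id)) => // w.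
by rewrite e; congr tword; apply: existT_inj (hr w).
Qed.

(** With kap' corresponding to -kap, this is (1 + eps D)(1 - eps D) = 1. *)
Lemma shear_cancel (V W : quiver R) (f : V -> W) (g : W -> V) (eps : R)
    (Phi : cocmap f) (Psi : cocmap g) (kap : Endo V) (kap' : Endo W)
    (rf : forall A C, word V A C -> word W (f A) (f C))
    (rg : forall A C, word W A C -> word V (g A) (g C)) :
  eps * eps = 0 ->
  (forall A C w, Phi A C (tword w) =
     tword (rf A C w) - eps *: insum 0 kap (fun v => tword (rf A C v)) w) ->
  (forall A C w, Psi A C (tword w) =
     tword (rg A C w) - eps *: insum 0 kap' (fun v => tword (rg A C v)) w) ->
  (forall A C w, insum 0 kap' (fun v => tword (rg (f A) (f C) v)) (rf A C w) =
     - insum 0 kap (fun v => tword (rg _ _ (rf A C v))) w) ->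
  (forall A, g (f A) = A) ->
  (forall A C w, existT (@words V) (g (f A), g (f C)) (rg _ _ (rf A C w)) =
                 existT (@words V) (A, C) w) ->
  cancel (arrow_map Phi) (arrow_map Psi).
Proof.
move=> e2 hPhi hPsi hins hgf hw [[A C] z]; rewrite /arrow_map /=.
apply: (@tcoc_transport V A C _ _ (fun w => rg _ _ (rf A C w))
  (fun z => Psi _ _ (Phi A C z))) => // [c x y|w].
  by rewrite !linearP.
rewrite hPhi (linear_sub _ _ _ (linearP (Psi _ _))) (linear_insum _ _ _ _ (linearP (Psi _ _))).
rewrite (@eq_insum _ _ _ _ _ _ _ _ _ w (fun v => hPsi _ _ (rf A C v))) hPsi.
rewrite /insum sumrB -scaler_sumr scalerBr scalerA e2 scale0r subr0.
by rewrite -!/(insum _ _ _ _) hins scalerN opprK addrK.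
Qed.

End Cancellation.

(** * The total deformations *)

Section Total.
Variables (k : comPzRingType) (a : quiver k).
Local Notation qp := (qpsi a).
Local Notation V := (qshift qp).
Local Notation DV := (qshift (qdual qp)).

Section Structure.
Variables mu phi : CC a.
Hypotheses (hmu : cAinf_structure mu) (hphi : hcocycle mu 2 phi).

Let mu1 : of_degree 1 (cpsi mu).
Proof. exact: (@cpull_degree k (qshift a) (psiOb a) (@psi_under k a) 1 mu hmu.1). Qed.

Let phi1 : of_degree 1 (cpsi phi).
Proof. exact: (@cpull_degree k (qshift a) (psiOb a) (@psi_under k a) 1 phi hphi.1). Qed.

Lemma psi_degree : of_degree 0 (@psi_cochain k a).
Proof. by apply: zcochain_degree => o; exact: (svalP (projT2 o)). Qed.

Lemma mu_tot_eps_degree : of_degree 1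
  (fun A C w => cpsi phi w + brace (cpsi mu) [:: (0, @psi_cochain k a)] (A := A) (C := C) w).
Proof.
apply: degreeD; first exact: phi1.
exact: (@brace_degree k V 1 0 0 (cpsi mu) _ mu1 psi_degree).
Qed.

Lemma cpsi_brace p (al be : CC a) (A C : psiOb a) (w : word V A C) :
  brace (cpsi al) [:: (p, cpsi be)] w =
  brace al [:: (p, be)] (wpull (V := qshift a) (f := @psi_under k a) w).
Proof. exact: esym (@brace_wpull k (qshift a) _ (@psi_under k a) p al be A C w). Qed.

(** The coefficient of eps in the square is the sum of [mu, phi], zero as phi is a
   cocycle, and of mu{mu{psi}} + mu{psi}{mu}.  The latter is mu applied to the
   commutator of the coderivations of mu and psi, since psi{mu} = 0, and vanishes
   because mu{mu} = 0. *)
Lemma mu_tot_cAinf : cAinf_structure (mu_tot mu phi).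
Proof.
split; first exact: (cdual_degree mu1 mu_tot_eps_degree).
have mum : forall B D, multilinear (@cpsi k a mu B D) by move=> B D; exact: (mu1 B D).1.
have bm := fun B D => (mu_tot_eps_degree B D).1.
have mu0 (A C : psiOb a) (w : word V A C) : brace (cpsi mu) [:: (1, cpsi mu)] w = 0.
  by rewrite cpsi_brace hmu.2.
have phi0 (A C : psiOb a) (w : word V A C) :
    brace (cpsi phi) [:: (1, cpsi mu)] w + brace (cpsi mu) [:: (1, cpsi phi)] w = 0.
  rewrite !cpsi_brace; have := hphi.2 _ _ (wpull (V := qshift a) (f := @psi_under k a) w).
  by rewrite /dHoch /gbracket expr1 scaleN1r opprK addrC.
have psi0 (A C : psiOb a) (w : word V A C) :
    insum 1 (cpsi mu) (insum 0 (@psi_cochain k a) (@cpsi k a mu A C)) w +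
    insum 1 (fun B D v => brace (cpsi mu) [:: (0, @psi_cochain k a)] v) (@cpsi k a mu A C) w = 0.
  have hk B D (v : word V B D) :
    iter `|1%Z|%N (@gsign _ _) (@psi_cochain k a B D v) = @psi_cochain k a B D (wsign 1 v).
    exact: gsign_degree0 psi_degree.
  have := @insum_commutator k V _ 1 (cpsi mu) (@psi_cochain k a) A C _ w hk (@mum A C).
  rewrite [X in X - _]big1 ?sub0r; last by move=> v _; apply: mu0.
  move=> e; rewrite addrC; apply/eqP; rewrite addr_eq0; apply/eqP.
  apply: etrans (esym e); apply: eq_insum_cochain => B D v.
  by rewrite brace_zcochain subr0.
move=> A C w; rewrite /mu_tot (brace_cdual _ _ mum bm mum bm) /cdual mu0.
rewrite [X in _ + X]big1 => [|v _]; last exact: mu0.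
congr pair; rewrite addr0; move: (wbody w) => v.
rewrite [X in X + _]insumD [X in _ + X]insum_cochainD //.
by rewrite addrACA phi0 psi0 addr0.
Qed.

End Structure.

Section Shift.
Variables (eta : CC a) (heta : hochschild 1 eta).
Local Notation f := (psi_shift heta).

Lemma nonzero_degree : of_degree 0 (cpsi (nonzero_part eta)).
Proof.
apply: (@cpull_degree k (qshift a) (psiOb a) (@psi_under k a) 0 (nonzero_part eta)).
apply: (degreeD heta); apply: degreeN; apply: zcochain_degree => A.
exact: (@zero_part_homog k a eta A heta).
Qed.

(** The k[eps]-linear extension of eta', chosen so that eta' eps = eps kap. *)
Definition shift_kap : CC (qdual qp) := cdual (cpsi (nonzero_part eta)) (fun A C w => 0).

Lemma shift_kap_degree : of_degree 0 shift_kap.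
Proof.
apply: cdual_degree; first exact: nonzero_degree.
by move=> A C; split=> [B D u v c x y|w d _]; rewrite ?scaler0 ?addr0 // /homog linear0.
Qed.

Lemma shift_kap0 (o : psiOb a) : shift_kap (wnil (V := DV) o) = 0.
Proof.
by congr pair; rewrite /= ?big_nil ?addr0 // /cpsi /cpull /nonzero_part /= subrr.
Qed.

Lemma shift_morphismE A C (w : word DV A C) :
  shift_morphism heta w = idcochain (V := DV) w - (dual_eps k) *: shift_kap w.
Proof.
exact: (@cdual_id k qp A C w (cpsi (nonzero_part eta)) (fun B D => (nonzero_degree B D).1)).
Qed.

Lemma cpsi_shift (al : CC a) A C (w : word V A C) :
  cpsi al (@wpull k V (psiOb a) f A C w) = cpsi al w.
Proof.
rewrite /cpsi /cpull; congr (al _ _ _).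
by elim: w => //= D B E x w ->.
Qed.

Lemma wpull_pure A C (w : word V A C) :
  @wpull _ DV (psiOb a) f A C (wpure w) = wpure (@wpull k V (psiOb a) f A C w).
Proof. by elim: w => //= D B E x w ->. Qed.

Local Notation zpsi := (zcochain (V := V) (fun o : psiOb a => zero_part eta (psi_under o))).

(** This is where f enters: psi - eta^0 is the pullback of psi along f. *)
Lemma brace_psi_shift (mu : CC a) (mum : forall B D, multilinear (@mu B D)) A C (w : word V A C) :
  brace (cpsi mu) [:: (0, @psi_cochain k a)] (@wpull k V (psiOb a) f A C w) =
  brace (cpsi mu) [:: (0, @psi_cochain k a)] w - brace (cpsi mu) [:: (0, zpsi)] w.
Proof.
rewrite (@brace_wpull k V (psiOb a) f 0 (cpsi mu) (@psi_cochain k a) A C w).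
have e B D (v : word V B D) :
    cpull V f (@psi_cochain k a) B D v = @psi_cochain k a B D v + (-1) *: zpsi v.
  rewrite scaleN1r; case: B D / v => [B|B D E x v]; first by [].
  by rewrite /cpull /= subr0.
transitivity (insum 0 (cpull V f (@psi_cochain k a)) (@cpsi k a mu A C) w).
  by apply: eq_insum => v; rewrite -[RHS]cpsi_shift.
rewrite (eq_insum_cochain _ _ _ e) insum_cochainDZ ?scaleN1r //.
exact: (@mlin_wpull k (qshift a) (psiOb a) (@psi_under k a) _ A C _ (mum _ _)).
Qed.

Lemma cpsi_nonzero A C (w : word V A C) :
  cpsi (nonzero_part eta) w = cpsi eta w - zpsi w.
Proof. by rewrite /cpsi /cpull /nonzero_part; case: A C / w. Qed.

Variables mu phi phi' : CC a.
Hypotheses (hmu : cAinf_structure mu)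
    (hphi : hcocycle mu 2 phi) (hphi' : hcocycle mu 2 phi').
Hypothesis hd : forall (A C : a) (w : word (qshift a) A C),
        dHoch mu 1 eta w = @phi' A C w - @phi A C w.

(** On words without eps only the coefficients of eps are to be compared:
   phi + mu{psi} - phi' - mu{psi - eta^0} against eta'{mu} - mu{eta'}, which is
   the equation for d(eta) on a_Psi because eta^0{mu} = 0. *)
Lemma shift_first_order A C (w : word DV A C) :
  mu_tot mu phi w - mu_tot mu phi' (@wpull _ DV (psiOb a) f A C w) =
  (dual_eps k) *: (brace shift_kap [:: (1, mu_tot mu phi)] w
        - brace (mu_tot mu phi) [:: (0, shift_kap)] w).
Proof.
have mM := fun B D => ((mu_tot_cAinf hmu hphi).1 B D).1.
have mM' := fun B D => ((mu_tot_cAinf hmu hphi').1 B D).1.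
have mk := fun B D => (shift_kap_degree B D).1.
move: w; apply: wpure_ext => [||w].
- apply: mlinB; first exact: mM.
  exact: (@mlin_wpull _ DV (psiOb a) f _ A C (mu_tot mu phi' (A:=f A) (C:=f C)) (mM' _ _)).
- by apply: mlinZ; apply: mlinB; apply: (brace_mlin (V := DV)).
have muD := @cpull_degree k (qshift a) (psiOb a) (@psi_under k a) 1 mu hmu.1.
have mum : forall B D, multilinear (@cpsi k a mu B D) by move=> B D; exact: (muD B D).1.
have bm := fun B D => (mu_tot_eps_degree hmu hphi B D).1.
have bm' := fun B D => (mu_tot_eps_degree hmu hphi' B D).1.
have nm := fun B D => (nonzero_degree B D).1.
have zm B D : multilinear (fun _ : word V B D => 0 : qhom V B D).
  by move=> E F u v c x y; rewrite scaler0 addr0.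
rewrite wpull_pure {1 2}/mu_tot (cdual_pure _ _ (mum _ _)) (cdual_pure _ _ (mum _ _)).
rewrite /mu_tot /shift_kap (brace_cdual _ _ nm zm mum bm) (brace_cdual _ _ mum bm nm zm).
rewrite !cdual_pure; try exact: (brace_mlin (V := V)).
rewrite -[X in _ *: X]/((brace (cpsi (nonzero_part eta)) [:: (1, cpsi mu)] w -
  brace (cpsi mu) [:: (0, cpsi (nonzero_part eta))] w, _) : dual_mod _) eps_scale.
rewrite !cpsi_shift brace_psi_shift; last by move=> B D; exact: (hmu.1 B D).1.
congr pair => /=; first by rewrite subrr.
have := hd (wpull (V := qshift a) (f := @psi_under k a) w).
rewrite /dHoch /gbracket expr0 scale1r -!cpsi_brace => e.
have eN B D (v : word V B D) :
    cpsi (nonzero_part eta) v = cpsi eta v + (-1) *: zpsi v.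
  by rewrite scaleN1r cpsi_nonzero.
have -> : brace (cpsi mu) [:: (0, cpsi (nonzero_part eta))] w =
    brace (cpsi mu) [:: (0, cpsi eta)] w - brace (cpsi mu) [:: (0, zpsi)] w.
  by rewrite [LHS](eq_insum_cochain _ _ _ eN) insum_cochainDZ ?scaleN1r.
have -> : brace (cpsi (nonzero_part eta)) [:: (1, cpsi mu)] w =
    brace (cpsi eta) [:: (1, cpsi mu)] w.
  transitivity (insum 1 (cpsi mu) (fun v => @cpsi k a eta A C v + (- 1) *: zpsi v) w).
    exact: eq_insum.
  rewrite insumD insumZ.
  have z0 := @brace_zcochain k V 1 (fun o : psiOb a => zero_part eta (psi_under o)) (cpsi mu) A C w.
  by rewrite [X in _ + _ *: X]z0 scaler0 addr0.
have comb (M : zmodType) (x x' m n p z : M) : m - n = x' - x ->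
    x + p - (x' + (p - z)) = n - (m - z).
  move=> exx; rewrite -[x](subKr x') -exx (addrAC x') addrA !opprB.
  by rewrite (addrC (x' + p)) addrACA subrr addr0 -addrA (addrC z).
exact: comb e.
Qed.

End Shift.
End Total.

(** * Isomorphisms of deformations *)

Section Isomorphism.
Variables (k : comPzRingType) (a : quiver k).
Local Notation qp := (qpsi a).
Local Notation DV := (qshift (qdual qp)).

Local Notation fullq P := (@qfull _ (qdual qp) P).

Definition tot_map (eta : CC a) (heta : hochschild 1 eta) :
    @cocmap _ DV DV (psi_shift heta) :=
  @shear _ DV (psiOb a) (psi_shift heta) (dual_eps k) (shift_kap eta) (shift_kap_degree heta).

Lemma tot_extension (mu phi phi' eta : CC a) (hmu : cAinf_structure mu)
    (hphi : hcocycle mu 2 phi) (hphi' : hcocycle mu 2 phi') (heta : hochschild 1 eta)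
    (hd : forall (A C : a) (w : word (qshift a) A C),
        dHoch mu 1 eta w = phi' A C w - phi A C w) :
  cAinf_extension (mu_tot mu phi) (mu_tot mu phi') (shift_morphism heta) (tot_map heta).
Proof.
apply: (@shear_extension _ (qdual qp) (psiOb a) (psi_shift heta) (dual_eps k) (shift_kap eta)
  (shift_kap_degree heta) (mu_tot mu phi) (mu_tot mu phi') (shift_morphism heta)).
- exact: dual_eps_sq0.
- exact: shift_kap0.
- exact: mu_tot_cAinf.
- exact: mu_tot_cAinf.
- exact: shift_first_order.
- exact: shift_morphismE.
Qed.

Lemma tot_map_word (eta : CC a) (heta : hochschild 1 eta) A C (w : word DV A C) :
  tot_map heta A C (tword w) =
  tword (@wpull _ DV (psiOb a) (psi_shift heta) A C w) -
  dual_eps k *: insum 0 (shift_kap eta)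
    (fun v : word DV A C => tword (@wpull _ DV (psiOb a) (psi_shift heta) A C v)) w.
Proof. exact: shearE. Qed.

(** Restriction to full subcategories on objects satisfying P and Q, for
   predicates compatible with the object map. *)

Section Full.
Variables (P Q : psiOb a -> Prop) (eta : CC a) (heta : hochschild 1 eta).
Hypothesis hf : forall o, P o -> Q (psi_shift heta o).
Local Notation fullf := (@full_map _ (qdual qp) (qdual qp) P Q (psi_shift heta)).

Definition full_kap : CC (fullq P) := @cfull _ (qdual qp) P (shift_kap eta).

Lemma full_kap_degree : of_degree 0 full_kap.
Proof. exact: (@cpull_degree _ DV _ (fun o : {o | P o} => sval o) 0 _ (shift_kap_degree heta)). Qed.

Definition full_cocmap :
    @cocmap _ (qshift (fullq P)) (qshift (fullq Q)) (fullf hf) :=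
  @shear _ (qshift (fullq Q)) {o | P o} (fullf hf) (dual_eps k) full_kap full_kap_degree.

Lemma full_cocmap_word A C (w : word (qshift (fullq P)) A C) :
  full_cocmap A C (tword w) =
  tword (@wpull _ (qshift (fullq Q)) _ (fullf hf) A C w) -
  dual_eps k *: insum 0 full_kap (fun v : word (qshift (fullq P)) A C =>
    tword (@wpull _ (qshift (fullq Q)) _ (fullf hf) A C v)) w.
Proof. exact: shearE. Qed.

Lemma wpull_full A C (w : word (qshift (fullq P)) A C) :
  @wpull _ DV {o | Q o} (fun o => sval o) _ _
     (@wpull _ (qshift (fullq Q)) _ (fullf hf) A C w) =
  @wpull _ DV (psiOb a) (psi_shift heta) _ _ (@wpull _ DV {o | P o} (fun o => sval o) _ _ w).
Proof. by elim: w => //= D B E x w ->. Qed.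

Lemma full_extension (mu phi phi' : CC a) (hmu : cAinf_structure mu)
    (hphi : hcocycle mu 2 phi) (hphi' : hcocycle mu 2 phi')
    (hd : forall (A C : a) (w : word (qshift a) A C),
        dHoch mu 1 eta w = phi' A C w - phi A C w) :
  cAinf_extension (@cfull _ (qdual qp) P (mu_tot mu phi)) (@cfull _ (qdual qp) Q (mu_tot mu phi'))
    (@crestrict _ (qdual qp) (qdual qp) P Q (psi_shift heta) hf (shift_morphism heta)) full_cocmap.
Proof.
apply: (@shear_extension _ (fullq Q) {o | P o} (fullf hf) (dual_eps k) full_kap
  full_kap_degree (@cfull _ (qdual qp) P (mu_tot mu phi)) (@cfull _ (qdual qp) Q (mu_tot mu phi'))
  (@crestrict _ (qdual qp) (qdual qp) P Q (psi_shift heta) hf (shift_morphism heta))).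
- exact: dual_eps_sq0.
- by move=> A; exact: (@shift_kap0 k a eta (sval A)).
- exact: (@cAinf_pull _ (qdual qp) {o | P o} (fun o => sval o) _ (mu_tot_cAinf hmu hphi)).
- exact: (@cAinf_pull _ (qdual qp) {o | Q o} (fun o => sval o) _ (mu_tot_cAinf hmu hphi')).
- move=> A C w; pose wP := @wpull _ DV {o | P o} (fun o => sval o) _ _ w.
  have := shift_first_order heta hmu hphi hphi' hd wP.
  rewrite /wP !(@brace_wpull _ DV {o | P o} (fun o => sval o)) -wpull_full.
  exact.
move=> A C w; rewrite /crestrict [LHS]shift_morphismE; congr (_ - _).
case: A C / w => [D|D B E x w]; first by [].
by case: D B / w x.
Qed.

End Full.

Section Inverse.
Variables (eta theta : CC a) (heta : hochschild 1 eta) (htheta : hochschild 1 theta).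
Hypothesis opp : forall A C w, @theta A C w = - @eta A C w.

Lemma psi_point_shiftK (A : a) (t : {x : qhom a A A | homog 1 x}) :
  projT2 (psi_shift htheta (psi_shift heta (existT _ A t))) = t.
Proof.
case: t => x hx; apply: eq_exist; rewrite /psi_val /= /zero_part opp.
by rewrite opprK subrK.
Qed.

Lemma psi_shiftK o : psi_shift htheta (psi_shift heta o) = o.
Proof. by case: o => A t; rewrite -[in RHS](psi_point_shiftK t). Qed.

Lemma shift_kap_opp A C (w : word DV A C) :
  shift_kap theta (@wpull _ DV (psiOb a) (psi_shift heta) A C w) = - shift_kap eta w.
Proof.
move: w; apply: wpure_ext => [||w].
- exact: (@mlin_wpull _ DV (psiOb a) (psi_shift heta) _ A C _
    (shift_kap_degree htheta _ _).1).
- exact/mlinN/(shift_kap_degree heta _ _).1.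
have nm (z : CC a) (hz : hochschild 1 z) B D := (nonzero_degree hz B D).1.
rewrite wpull_pure /shift_kap !cdual_pure; try exact: nm.
rewrite cpsi_shift; congr pair; last by rewrite /= oppr0.
rewrite /cpsi /cpull /nonzero_part /= opp opprB.
case: (wpull (V := qshift a) (f := @psi_under k a) w) => [B|*] /=.
  by rewrite /zero_part opp opprK addrC.
by rewrite subr0 sub0r.
Qed.

(** The hom-modules do not depend on the psi's, so only the end points of a letter
   move, and they return to where they were. *)
Lemma psi_letter (A C : psiOb a) (x : qhom DV A C) :
  existT (@arrows _ DV) (psi_shift htheta (psi_shift heta A),
                       psi_shift htheta (psi_shift heta C)) x =
  existT (@arrows _ DV) (A, C) x.
Proof.
case: A C x => [A t] [C s] x.
pose F (z : {x : qhom a A A | homog 1 x} * {x : qhom a C C | homog 1 x}) :=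
  existT (@arrows _ DV) (existT _ A z.1 : psiOb a, existT _ C z.2 : psiOb a) x.
exact: (congr1 F (congr2 pair (psi_point_shiftK t) (psi_point_shiftK s))).
Qed.

Lemma tot_map_cancel : cancel (arrow_map (tot_map heta)) (arrow_map (tot_map htheta)).
Proof.
apply: (@shear_cancel _ DV DV (psi_shift heta) (psi_shift htheta) (dual_eps k)
  (tot_map heta) (tot_map htheta) (shift_kap eta) (shift_kap theta)
  (@wpull _ DV (psiOb a) (psi_shift heta)) (@wpull _ DV (psiOb a) (psi_shift htheta))).
- exact: dual_eps_sq0.
- exact: tot_map_word.
- exact: tot_map_word.
- move=> A C w; rewrite (@insum_wpull _ DV (psiOb a) (psi_shift heta)).
  apply: (@insum_cochainN _ DV) => [|B D v]; last exact: shift_kap_opp.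
  exact: (@mlin_wpull _ DV (psiOb a) (psi_shift heta) _ A C _
    (@mlin_wpull _ DV (psiOb a) (psi_shift htheta) _ _ _ _ (@tword_mlin _ DV _ _))).
- exact: psi_shiftK.
move=> A C w.
apply: (@word_transport _ DV (fun o => psi_shift htheta (psi_shift heta o))
  (fun A C (x : qhom DV A C) => x)
  (fun A C (w : word DV A C) => @wpull _ DV (psiOb a) (psi_shift htheta) _ _
      (@wpull _ DV (psiOb a) (psi_shift heta) A C w))) => //.
  exact: psi_shiftK.
exact: psi_letter.
Qed.

Variables (P Q : psiOb a -> Prop).
Hypothesis hf : forall o, P o -> Q (psi_shift heta o).
Hypothesis hg : forall o, Q o -> P (psi_shift htheta o).

Local Notation full_f := (@full_map _ (qdual qp) (qdual qp) P Q (psi_shift heta) hf).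
Local Notation full_g := (@full_map _ (qdual qp) (qdual qp) Q P (psi_shift htheta) hg).

Lemma full_shiftK o : full_g (full_f o) = o.
Proof. by case: o => o ho; apply: eq_exist; apply: psi_shiftK. Qed.

Lemma full_letter (A C : {o | P o}) (x : qhom (qshift (fullq P)) A C) :
  existT (@arrows _ (qshift (fullq P))) (full_g (full_f A), full_g (full_f C)) x =
  existT (@arrows _ (qshift (fullq P))) (A, C) x.
Proof.
case: A C x => [[A t] hA] [[C s] hC] x.
have irr t' s' (hA' : P (existT _ A t')) (hC' : P (existT _ C s')) : t' = t -> s' = s ->
    existT (@arrows _ (qshift (fullq P)))
      (exist P (existT _ A t') hA', exist P (existT _ C s') hC') x =
    existT (@arrows _ (qshift (fullq P)))
      (exist P (existT _ A t) hA, exist P (existT _ C s) hC) x.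
  move=> et es; move: hA' hC'; rewrite et es => hA' hC'.
  by rewrite (Prop_irrelevance hA' hA) (Prop_irrelevance hC' hC).
by apply: irr; apply: psi_point_shiftK.
Qed.

Lemma full_kap_opp A C (w : word (qshift (fullq P)) A C) :
  full_kap theta (@wpull _ (qshift (fullq Q)) _
    full_f A C w) = - full_kap eta w.
Proof. by rewrite /full_kap /cfull /cpull wpull_full; apply: shift_kap_opp. Qed.

Lemma full_cancel : cancel (arrow_map (full_cocmap hf)) (arrow_map (full_cocmap hg)).
Proof.
apply: (@shear_cancel _ (qshift (fullq P)) (qshift (fullq Q)) _ _ (dual_eps k)
  (full_cocmap hf) (full_cocmap hg) (@full_kap P eta) (@full_kap Q theta)
  (@wpull _ (qshift (fullq Q)) _ full_f)
  (@wpull _ (qshift (fullq P)) _ full_g)).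
- exact: dual_eps_sq0.
- exact: full_cocmap_word.
- exact: full_cocmap_word.
- move=> A C w; rewrite (@insum_wpull _ (qshift (fullq Q)) _
    full_f).
  apply: (@insum_cochainN _ (qshift (fullq P))) => [|B D v]; last exact: full_kap_opp.
  exact: (@mlin_wpull _ (qshift (fullq Q)) _
    full_f _ A C _
    (@mlin_wpull _ (qshift (fullq P)) _
      full_g _ _ _ _
      (@tword_mlin _ (qshift (fullq P)) _ _))).
- exact: full_shiftK.
move=> A C w.
apply: (@word_transport _ (qshift (fullq P)) (fun o => full_g (full_f o))
  (fun A C (x : qhom (qshift (fullq P)) A C) => x)
  (fun A C (w : word (qshift (fullq P)) A C) => @wpull _ (qshift (fullq P)) _ 
     full_g _ _
      (@wpull _ (qshift (fullq Q)) _
    full_f A C w))) => //.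
  exact: full_shiftK.
exact: full_letter.
Qed.

End Inverse.

Section CurvatureCompensating.
Variables (mu phi phi' eta : CC a) (heta : hochschild 1 eta).
Hypotheses (hmu : cAinf_structure mu)
    (hphi : hcocycle mu 2 phi) (hphi' : hcocycle mu 2 phi').
Hypothesis hd : forall (A C : a) (w : word (qshift a) A C),
  dHoch mu 1 eta w = @phi' A C w - @phi A C w.

(** The first order relation at the empty word: both braces insert a zero letter,
   kap having no zero part and M having zero curvature at o. *)
Lemma cc_shift o : ccOb mu phi o -> ccOb mu phi' (psi_shift heta o).
Proof.
rewrite /ccOb /curvature => h0.
have := shift_first_order heta hmu hphi hphi' hd (wnil (V := DV) o).
rewrite [X in _ = _ *: (X - _)]insum_nil [X in _ = _ *: (_ - X)]insum_nil h0 shift_kap0.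
have mM := ((mu_tot_cAinf hmu hphi).1 o o).1.
have mk := (shift_kap_degree heta o o).1.
rewrite (mlin_head0 _ mM) (mlin_head0 _ mk) subrr scaler0 sub0r => /eqP.
by rewrite oppr_eq0 => /eqP.
Qed.

Lemma hochschild_opp : hochschild 1 (fun A C w => - @eta A C w).
Proof. exact: degreeN heta. Qed.

Lemma dHoch_opp A C (w : word (qshift a) A C) :
  dHoch mu 1 (fun A C w => - @eta A C w) w = @phi A C w - @phi' A C w.
Proof.
rewrite -[RHS]opprB -hd /dHoch /gbracket opprB expr0 !scale1r addrC.
have mm B D : multilinear (@mu B D) := (hmu.1 B D).1.
congr (_ + _); first by rewrite /brace sumrN opprK.
by apply: (@insum_cochainN _ (qshift a) (qhom (qshift a) A C) 0 _ _ A C (@mu A C)).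
Qed.

End CurvatureCompensating.
End Isomorphism.

Theorem proposition4p5 (k : comPzRingType) (a : quiver k) (mu phi phi' eta : CC a)
    (hmu : cAinf_structure mu)
    (hphi : hcocycle mu 2 phi) (hphi' : hcocycle mu 2 phi')
    (heta : hochschild 1 eta)
    (hd : forall (A C : a) (w : word (qshift a) A C),
        dHoch mu 1 eta w = phi' A C w - phi A C w) :
  uncurved (shift_morphism heta) /\
  cAinf_isomorphism (mu_tot mu phi) (mu_tot mu phi') (shift_morphism heta) /\
  exists hf : forall o, ccOb mu phi o -> ccOb mu phi' (psi_shift heta o),
    Ainf_isomorphism
      (cfull (ccOb mu phi) (mu_tot mu phi))
      (cfull (ccOb mu phi') (mu_tot mu phi'))
      (crestrict hf (shift_morphism heta)).
Proof.
have hunc : uncurved (shift_morphism heta).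
  by move=> o; rewrite shift_morphismE shift_kap0 scaler0 subr0.
have hN := hochschild_opp heta; have hdN := dHoch_opp hmu hd.
have hopp A C w : eta A C w = - - eta A C w by rewrite opprK.
split=> //; split.
  exists (tot_map heta), (psi_shift hN), (shift_morphism hN), (tot_map hN); split.
  - exact: tot_extension.
  - exact: tot_extension.
  - exact: tot_map_cancel.
  - exact: tot_map_cancel.
pose hf := cc_shift heta hmu hphi hphi' hd.
pose hg := cc_shift hN hmu hphi' hphi hdN.
exists hf; split.
- split; last by case.
  exact: (@cAinf_pull _ (qdual (qpsi a)) _ (fun o => sval o) _ (mu_tot_cAinf hmu hphi)).
- split; last by case.
  exact: (@cAinf_pull _ (qdual (qpsi a)) _ (fun o => sval o) _ (mu_tot_cAinf hmu hphi')).
- by case=> o ho; apply: hunc.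
exists (full_cocmap hf), _, (crestrict hg (shift_morphism hN)), (full_cocmap hg); split.
- exact: full_extension.
- exact: full_extension.
- exact: full_cancel.
- exact: full_cancel.
Qed.
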